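(* For all integers $d,m\ge 1$, all $B>0$ and all $n\ge 1$: \begin{align*} e_n(\mathcal F_{d,m,B},S_L,D_{\mathrm{abs}})&=\Theta_{m,d}(Bn^{-m/d}), & e^{\mathrm{ad}}_n(\mathcal F_{d,m,B},S_L,D_{\mathrm{abs}})&=\Theta_{m,d}(Bn^{-m/d}),\\ e_n(\mathcal F_{d,m,B},S_{\mathrm{samp}},D_{\sup\text{-}\log})&=\Theta_{m,d}(Bn^{-m/d}), & e^{\mathrm{ad}}_n(\mathcal F_{d,m,B},S_{\mathrm{samp}},D_{\sup\text{-}\log})&=\Theta_{m,d}(Bn^{-m/d}),\\ e_n(\mathcal F_{d,m,B},S_{\mathrm{samp}},D_{\mathrm{TV}})&=\Theta_{m,d}(\min\{1,Bn^{-m/d}\}), & e^{\mathrm{ad}}_n(\mathcal F_{d,m,B},S_{\mathrm{samp}},D_{\mathrm{TV}})&=\Theta_{m,d}(\min\{1,Bn^{-m/d}\}),\\ e_n(\mathcal F_{d,m,B},S_{\mathrm{samp}},W_1)&=\Theta_{m,d}(\min\{1,Bn^{-m/d}\}), & e^{\mathrm{ad}}_n(\mathcal F_{d,m,B},S_{\mathrm{samp}},W_1)&=\Theta_{m,d}(\min\{1,Bn^{-m/d}\}). \end{align*}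
   Context: Let $\mathcal X=[0,1]^d$ with Lebesgue measure. For bounded measurable $f:\mathcal X\to\mathbb R$ let $Z_f=\int_{\mathcal X}e^{f(x)}\,dx$, $L_f=\log Z_f$, and $P_f$ the probability distribution on $\mathcal X$ with density $e^{f}/Z_f$. For $f\in C^m(\mathcal X)$, $\|f\|_{C^m}=\sup_{\alpha\in\mathbb N_0^d,|\alpha|_1\le m}\|\partial^\alpha f\|_\infty$, and $\mathcal F_{d,m,B}=\{f\in C^m(\mathcal X):\|f\|_{C^m}\le B\}$. Problems: $S_L(f)=L_f$ with metric $D_{\mathrm{abs}}(a,b)=|a-b|$ on $\mathbb R$; $S_{\mathrm{samp}}(f)=P_f$ with values in the set of probability distributions on $\mathcal X$, compared with: the sup-log distance $D_{\sup\text{-}\log}(P,Q)=\|\log(dP/dQ)\|_\infty$ (essential sup over $\mathcal X$; $=\infty$ unless $P,Q$ are mutually absolutely continuous), the total variation distance $D_{\mathrm{TV}}(P,Q)=\sup_{A\text{ measurable}}|P(A)-Q(A)|$, and the 1-Wasserstein distance $W_1(P,Q)=\inf_{X\sim P,Y\sim Q}\mathbb E\|X-Y\|_2$. Algorithms: $\mathcal A_n$ is the set of maps $\tilde S=\phi\circ N$ with $N(f)=(f(x_1),\dots,f(x_n))$ for some fixed points $x_1,\dots,x_n\in\mathcal X$ and an arbitrary map $\phi$ from $\mathbb R^n$ to the output space; $\mathcal A^{\mathrm{ad}}_n$ is the analogous set where the $k$-th point $x_k$ may depend on $f(x_1),\dots,f(x_{k-1})$. For a class $\mathcal F$, problem $S$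 and metric $D$: $e_n(\mathcal F,S,D)=\inf_{\tilde S\in\mathcal A_n}\sup_{f\in\mathcal F}D(S(f),\tilde S(f))$ and $e^{\mathrm{ad}}_n$ likewise with $\mathcal A^{\mathrm{ad}}_n$. Asymptotic notation: $g\le O_{m,d}(h)$ means that for all $m,d$ there is $C_{m,d}>0$ with $g\le C_{m,d}h$ for all $B>0$ and all $n\ge1$; $g\ge\Omega_{m,d}(h)$ means $h\le O_{m,d}(g)$; $\Theta_{m,d}$ means both. *)

(* Defs.v *)
From HB Require Import structures.
From mathcomp Require Import all_boot all_order all_algebra.
From mathcomp Require Import all_classical all_reals all_analysis.
From mathcomp Require Import ess_sup_inf.
Set Implicit Arguments. Unset Strict Implicit. Unset Printing Implicit Defensive.
Import Order.TTheory GRing.Theory Num.Theory.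
Import numFieldNormedType.Exports.
Local Open Scope classical_set_scope.
Local Open Scope ring_scope.

Section defs.
Variable R : realType.

Definition cube (d : nat) : set (d.-tuple R) :=
  [set x | forall i : 'I_d, 0 <= tnth x i <= 1].

Fixpoint iint (n : nat) : (n.-tuple R -> \bar R) -> \bar R :=
  match n return (n.-tuple R -> \bar R) -> \bar R with
  | 0 => fun g => g [tuple]
  | n'.+1 => fun g =>
      (\int[@lebesgue_measure R]_(x in `[0%R, 1%R]) iint (fun t => g (cons_tuple x t)))%E
  end.

(** Lebesgue measure (restricted to the cube) of a set, via Tonelli *)
Definition leb_cube (d : nat) (A : set (d.-tuple R)) : \bar R :=
  iint (fun t => (\1_A t)%:E).

Definition interior_cube (d : nat) : set (d.-tuple R) :=
  [set x | forall i : 'I_d, 0 < tnth x i < 1].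

Definition upd (d : nat) (x : d.-tuple R) (i : 'I_d) (t : R) : d.-tuple R :=
  [tuple if j == i then t else tnth x j | j < d].

Definition partial (d : nat) (i : 'I_d) (g : d.-tuple R -> R) : d.-tuple R -> R :=
  fun x => derive1 (fun t => g (upd x i t)) (tnth x i).

Fixpoint dpart (d : nat) (s : seq 'I_d) (g : d.-tuple R -> R) : d.-tuple R -> R :=
  match s with
  | [::] => g
  | i :: s' => partial i (dpart s' g)
  end.

Definition cont_on_cube (d : nat) (g : d.-tuple R -> R) : Prop :=
  forall x, cube x -> forall e : R, 0 < e -> exists2 delta : R, 0 < delta &
    forall y, cube y -> (forall i : 'I_d, `|tnth y i - tnth x i| < delta) ->
      `|g y - g x| < e.

Definition in_Cm (d m : nat) (f : d.-tuple R -> R) : Prop :=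
  [/\ cont_on_cube f,
      (forall (i : 'I_d) (s : seq 'I_d), (size s < m)%N ->
         forall x, interior_cube x -> derivable (fun t => dpart s f (upd x i t)) (tnth x i) 1)
    & (forall s : seq 'I_d, (0 < size s <= m)%N ->
         exists G : d.-tuple R -> R, cont_on_cube G /\
           forall x, interior_cube x -> G x = dpart s f x)].

(** ||f||_{C^m} = max_{|alpha| <= m} sup_X |d^alpha f| (the sup of a
    continuous function over X equals its sup over the interior) *)
Definition Cm_norm (d m : nat) (f : d.-tuple R -> R) : \bar R :=
  ereal_sup ([set (`|f x|)%:E | x in @cube d] `|`
             [set (`|dpart s f x|)%:E | s in [set s : seq 'I_d | (0 < size s <= m)%N] &
                                         x in @interior_cube d]).

Definition Fclass (d m : nat) (B : R) : set (d.-tuple R -> R) :=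
  [set f | in_Cm m f /\ (Cm_norm m f <= B%:E)%E].

Definition Zf (d : nat) (f : d.-tuple R -> R) : R :=
  fine (iint (fun t => (expR (f t))%:E)).

Definition Lf (d : nat) (f : d.-tuple R -> R) : R := ln (Zf f).

Definition Pf (d : nat) (f : d.-tuple R -> R) : set (d.-tuple R) -> \bar R :=
  fun A => (iint (fun t => (\1_A t * expR (f t))%:E) * ((Zf f)^-1)%:E)%E.

Definition D_abs (a b : R) : \bar R := (`|a - b|)%:E.

Definition D_TV (d : nat) (P : set (d.-tuple R) -> \bar R) (Q : probability (d.-tuple R) R)
  : \bar R := ereal_sup [set (`|P A - Q A|)%E | A in [set A | measurable A]].

(** || log dP/dQ ||_oo (essential sup w.r.t. Q); +oo unless P, Q mutually
    absolutely continuous, i.e. unless dP/dQ exists and is positive *)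
Definition D_suplog (d : nat) (P : set (d.-tuple R) -> \bar R) (Q : probability (d.-tuple R) R)
  : \bar R :=
  ereal_inf [set c | exists h : d.-tuple R -> R,
    [/\ measurable_fun setT h, (forall x, 0 < h x),
        (forall A, measurable A -> P A = \int[Q]_(x in A) (h x)%:E)%E
      & c = ess_sup Q (fun x => (`|ln (h x)|)%:E)]].

Definition eucl (d : nat) (x y : d.-tuple R) : R :=
  Num.sqrt (\sum_(i < d) (tnth x i - tnth y i) ^+ 2).

Definition W1 (d : nat) (P : set (d.-tuple R) -> \bar R) (Q : probability (d.-tuple R) R)
  : \bar R :=
  ereal_inf [set c | exists pi : probability (d.-tuple R * d.-tuple R)%type R,
    [/\ (forall A, measurable A -> pi (A `*` setT) = P A),
        (forall A, measurable A -> pi (setT `*` A) = Q A)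
      & c = (\int[pi]_z (eucl z.1 z.2)%:E)%E]].

Definition distr_on_cube (d : nat) (Q : probability (d.-tuple R) R) : Prop :=
  Q (@cube d) = 1%E.

Definition err_n (d : nat) (Sol Out : Type) (F : set (d.-tuple R -> R))
  (S : (d.-tuple R -> R) -> Sol) (valid : Out -> Prop) (D : Sol -> Out -> \bar R)
  (n : nat) : \bar R :=
  ereal_inf [set e | exists (xs : n.-tuple (d.-tuple R)) (phi : n.-tuple R -> Out),
    [/\ forall k : 'I_n, cube (tnth xs k), forall y, valid (phi y)
      & e = ereal_sup [set D (S f) (phi (map_tuple f xs)) | f in F]]].

Fixpoint adinfo (d : nat) (psi : seq R -> d.-tuple R) (f : d.-tuple R -> R) (k : nat)
  : seq R :=
  match k with
  | 0 => [::]
  | k'.+1 => let h := adinfo psi f k' in rcons h (f (psi h))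
  end.

Definition err_ad_n (d : nat) (Sol Out : Type) (F : set (d.-tuple R -> R))
  (S : (d.-tuple R -> R) -> Sol) (valid : Out -> Prop) (D : Sol -> Out -> \bar R)
  (n : nat) : \bar R :=
  ereal_inf [set e | exists (psi : seq R -> d.-tuple R) (phi : seq R -> Out),
    [/\ forall h, cube (psi h), forall y, valid (phi y)
      & e = ereal_sup [set D (S f) (phi (adinfo psi f n)) | f in F]]].

Definition Theta_md (e : nat -> nat -> R -> nat -> \bar R) (h : nat -> nat -> R -> nat -> R)
  : Prop :=
  forall m d : nat, (0 < m)%N -> (0 < d)%N ->
    exists C1 C2 : R, [/\ 0 < C1, 0 < C2 &
      forall (B : R) (n : nat), 0 < B -> (0 < n)%N ->
        ((C1 * h m d B n)%:E <= e m d B n /\ e m d B n <= (C2 * h m d B n)%:E)%E].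

Definition rate (m d : nat) (B : R) (n : nat) : R :=
  B * (n%:R `^ (- (m%:R / d%:R))).

Definition rate1 (m d : nat) (B : R) (n : nat) : R := Num.min 1 (rate m d B n).

End defs.

(* Main.v *)
Require Import Defs.
From HB Require Import structures.
From mathcomp Require Import all_boot all_order all_algebra.
From mathcomp Require Import all_classical all_reals all_analysis.
From mathcomp Require Import measurable_realfun measurable_fun_approximation ess_sup_inf.
From mathcomp Require Import ring lra zify.
Set Implicit Arguments. Unset Strict Implicit. Unset Printing Implicit Defensive.
Import Order.TTheory GRing.Theory Num.Theory.
Import numFieldNormedType.Exports.
Local Open Scope classical_set_scope.
Local Open Scope ring_scope.

(** Upper bounds.  Given the values on a midpoint grid, the algorithm outputs the
    solution for any function of the class with these values.  Two functions of the class
    that agree on the grid differ by O(B N^-m) in sup norm: coordinate by coordinate, a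
    function of one variable that is small at 2^m separated nodes and has a bounded m-th
    derivative is small between the nodes.  A sup-norm error e perturbs log Z by at
    most e and the log-density by at most 2e, so the densities satisfy
    exp(-2e) p_g <= p_f; this bounds the total variation, and W_1 through the coupling that
    keeps the common part exp(-2e) P_g on the diagonal.

    Lower bounds.  Compare f = 0 with a sum f of disjoint nonnegative bumps, supported in
    [0,1/2]^d, over the cells which the points queried for f = 0 miss.  Both functions yield
    the same information, while Jensen gives log Z_f >= int f >= c B n^(-m/d).  On the
    half-space x_0 >= 1/2 the density of P_f is 1/Z_f, and a set or a Lipschitz function
    supported there separates P_f from P_0 in every metric. *)

(** * Functions of the class that agree on a grid *)

(** The constants of the rates may not depend on B, so the estimates cannot go through exp(B):
    densities are compared through their ratio, which the sup-norm error e alone controls. The cap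
    at 1 in the last two metrics comes from 1 - exp(-2e) above and 1 - exp(-t) below, each
    comparable to the minimum of 1 and the exponent. Jensen is needed, and not merely Z_f >= 1 + int
    f, because the bound on log Z_f must grow linearly in B. With bumps in half of the cube only,
    P_f on the other half is Lebesgue measure divided by Z_f, so a lower bound on Z_f is all that
    has to be known about f. Adaptivity does not help, since an algorithm that receives only zeros
    asks points fixed in advance. Two features of the definitions shape the details. Membership in
    the class gives derivatives only in the open cube, hence midpoint nodes and a final passage to
    the boundary by continuity. Integrals are iterated and functions are arbitrary outside the cube,
    hence the restriction of functions to the cube and the representation of the iterated integral
    by a probability measure. *)

Lemma mean_value (R : realType) (f df : R -> R) (x y : R) : x < y ->
  (forall t, x <= t <= y -> is_derive t 1 f (df t)) ->
  exists2 c, x < c < y & f y - f x = df c * (y - x).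
Proof.
move=> xy dfE.
have [||c] := @MVT R f df x y xy.
- by move=> t /[!in_itv]/= /andP[? ?]; apply: dfE; rewrite !ltW.
- apply: derivable_within_continuous => t /[!in_itv]/= txy.
  by have [] := dfE t txy.
by move=> /[!in_itv]/= ? ?; exists c.
Qed.

Lemma mean_value_le (R : realType) (f df : R -> R) (a b K x y : R) :
  (forall t, a <= t <= b -> is_derive t 1 f (df t)) ->
  (forall t, a <= t <= b -> `|df t| <= K) ->
  a <= x <= b -> a <= y <= b -> `|f y - f x| <= K * `|y - x|.
Proof.
move=> dfE dfK /andP[ax xb] /andP[ay yb].
wlog xy : x y ax xb ay yb / x <= y.
  move=> H; have [|/ltW yx] := leP x y; first exact: H.
  by rewrite distrC (distrC y); apply: H.
move: xy; rewrite le_eqVlt => /predU1P[->|xy]; first by rewrite !subrr normr0 mulr0.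
have [t /andP[xt ty]|c /andP[xc cy] ->] := @mean_value R f df x y xy.
  by apply: dfE; rewrite (le_trans ax xt) (le_trans ty yb).
rewrite normrM ler_wpM2r//; apply: dfK.
by rewrite (le_trans ax (ltW xc)) (le_trans (ltW cy) yb).
Qed.

(* In the inductive step the mean value theorem is applied on every second gap only, so that
   the new nodes for the derivative are again [delta]-separated; this is why 2^m nodes are used. *)
Lemma interpolation_bound (R : realType) (m : nat) (L : R) : 0 <= L ->
  exists2 C : R, 0 <= C &
  forall (delta eps B a b : R) (D : nat -> R -> R) (t : nat -> R),
    0 < delta -> 0 <= eps -> 0 <= B -> b - a <= L * delta ->
    (forall r x, (r < m)%N -> a <= x <= b -> is_derive x 1 (D r) (D r.+1 x)) ->
    (forall x, a <= x <= b -> `|D m x| <= B) ->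
    (forall j, (j < 2 ^ m)%N -> a <= t j <= b /\ `|D 0 (t j)| <= eps) ->
    (forall j, (j.+1 < 2 ^ m)%N -> t j + delta <= t j.+1) ->
    forall x, a <= x <= b -> `|D 0 x| <= C * (eps + B * delta ^+ m).
Proof.
move=> L0; elim: m => [|m [C C0 IH]].
  exists 1 => // delta eps B a b D t _ e0 _ _ _ DB _ _ x xab.
  by rewrite expr0 mulr1 mul1r (le_trans (DB x xab))// lerDr.
(* Integrating the derivative bound C (2 eps / delta + B delta^m) over a length of at most L delta
   gives eps + C L (2 eps + B delta^(m+1)); this constant absorbs all terms. *)
exists (1 + 2 * L * C); first by rewrite addr_ge0// !mulr_ge0.
move=> delta eps B a b D t d0 e0 B0 ab dD DB tab td x xab.
have tgap j : (j.+1 < 2 ^ m.+1)%N -> t j < t j.+1.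
  by move=> jm; apply: lt_le_trans (td j jm); rewrite ltrDl.
(* Across a gap of length at least delta the function changes by at most 2 eps, so its derivative is
   at most 2 eps / delta somewhere inside. Indices out of range get the dummy 0, which lets [choice]
   produce a total sequence. *)
have xiP (j : nat) : exists c, (j < 2 ^ m)%N ->
    t j.*2 < c < t j.*2.+1 /\ `|D 1%N c| <= 2 * eps / delta.
  have [jm|jm] := boolP (j < 2 ^ m)%N; last by exists 0.
  have jm1 : (j.*2.+1 < 2 ^ m.+1)%N by rewrite expnS mul2n -doubleS leq_double.
  have jm0 : (j.*2 < 2 ^ m.+1)%N by exact: ltnW.
  have [/andP[at0 _] e00] := tab _ jm0.
  have [/andP[_ tb1] e11] := tab _ jm1.
  have [s /andP[s1 s2]|c ctt Ec] := @mean_value R (D 0%N) (D 1%N) _ _ (tgap _ jm1).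
    by apply: dD => //; rewrite (le_trans at0 s1) (le_trans s2 tb1).
  exists c => _; split => //.
  rewrite ler_pdivlMr//.
  have dle : delta <= t j.*2.+1 - t j.*2 by rewrite lerBrDl td.
  apply: (@le_trans _ _ `|D 1%N c * (t j.*2.+1 - t j.*2)|).
    by rewrite normrM ler_wpM2l// (le_trans dle)// ler_norm.
  rewrite -Ec (le_trans (ler_normB _ _))//.
  by rewrite mulr_natl mulr2n lerD.
have [xi xiE] := choice xiP.
have D1 : forall x, a <= x <= b -> `|D 1%N x| <= C * (2 * eps / delta + B * delta ^+ m).
  apply: (IH delta _ B a b (fun r => D r.+1) xi) => //.
  - by rewrite !mulr_ge0// invr_ge0 ltW.
  - by move=> r y rm yab; apply: dD.
  - move=> j jm; have [/andP[c1 c2] ?] := xiE j jm; split => //.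
    have jm1 : (j.*2.+1 < 2 ^ m.+1)%N by rewrite expnS mul2n -doubleS leq_double.
    have [/andP[at0 _] _] := tab _ (ltnW jm1).
    have [/andP[_ tb1] _] := tab _ jm1.
    by rewrite (le_trans at0 (ltW c1)) (le_trans (ltW c2) tb1).
  - move=> j jm; have [/andP[_ c2] _] := xiE j (ltnW jm).
    have [/andP[c1 _] _] := xiE j.+1 jm.
    have jm2 : (j.*2.+2 < 2 ^ m.+1)%N by rewrite expnS mul2n -doubleS ltn_double.
    have := td _ jm2; rewrite -doubleS in c1 *; lra.
have [t0ab t0e] := tab 0%N (expn_gt0 2 m.+1).
have dD0 s : a <= s <= b -> is_derive s 1 (D 0%N) (D 1%N s) by apply: dD.
have := mean_value_le dD0 D1 t0ab xab => xt0.
have xL : `|x - t 0%N| <= L * delta.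
  apply: le_trans ab; rewrite ler_norml; lra.
have K0 : 0 <= C * (2 * eps / delta + B * delta ^+ m).
  by rewrite mulr_ge0// addr_ge0 ?mulr_ge0 ?invr_ge0 ?exprn_ge0// ltW.
have -> : D 0%N x = D 0%N (t 0%N) + (D 0%N x - D 0%N (t 0%N)) by rewrite addrC subrK.
apply: le_trans (ler_normD _ _) _.
apply: (@le_trans _ _ (eps + C * (2 * eps / delta + B * delta ^+ m) * (L * delta))).
  by rewrite lerD// (le_trans xt0)// ler_wpM2l.
have -> : eps + C * (2 * eps / delta + B * delta ^+ m) * (L * delta) =
   eps + C * L * (2 * eps + B * delta ^+ m.+1).
  rewrite exprS; field; exact: lt0r_neq0.
have Bd : 0 <= B * delta ^+ m.+1 by rewrite mulr_ge0// exprn_ge0// ltW.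
have CL : 0 <= C * L by rewrite mulr_ge0.
nra.
Qed.

Lemma tnth_upd (R : realType) d (x : d.-tuple R) (i j : 'I_d) (t : R) :
  tnth (upd x i t) j = if j == i then t else tnth x j.
Proof. by rewrite tnth_mktuple. Qed.

Lemma upd_id (R : realType) d (x : d.-tuple R) (i : 'I_d) : upd x i (tnth x i) = x.
Proof. by apply: eq_from_tnth => j; rewrite tnth_upd; case: eqP => [->|]. Qed.

Lemma upd_upd (R : realType) d (x : d.-tuple R) (i : 'I_d) (s t : R) :
  upd (upd x i s) i t = upd x i t.
Proof. by apply: eq_from_tnth => j; rewrite !tnth_upd; case: eqP. Qed.

Lemma interior_cube_upd (R : realType) d (x : d.-tuple R) (i : 'I_d) (t : R) :
  interior_cube x -> 0 < t < 1 -> interior_cube (upd x i t).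
Proof. by move=> xI tI j; rewrite tnth_upd; case: eqP. Qed.

Lemma interior_cube_sub (R : realType) d (x : d.-tuple R) : interior_cube x -> cube x.
Proof. by move=> xI j; have /andP[? ?] := xI j; rewrite !ltW. Qed.

Lemma Fclass_le (R : realType) d m (B : R) (f : d.-tuple R -> R) :
  Fclass m B f -> forall x, cube x -> `|f x| <= B.
Proof.
move=> [_ fB] x xI; rewrite -lee_fin (le_trans _ fB)//.
by apply: ereal_sup_ubound; left; exists x.
Qed.

Lemma Fclass_dpart_le (R : realType) d m (B : R) (f : d.-tuple R -> R) :
  Fclass m B f -> forall s x, (size s <= m)%N -> interior_cube x -> `|dpart s f x| <= B.
Proof.
move=> fB [|i s] x sm xI; first exact: Fclass_le fB _ (interior_cube_sub xI).
have [_] := fB; rewrite -lee_fin; apply: le_trans.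
by apply: ereal_sup_ubound; right; exists (i :: s) => //; exists x.
Qed.

Lemma Fclass_is_derive (R : realType) d m (B : R) (f : d.-tuple R -> R)
    (i : 'I_d) r (x : d.-tuple R) (t : R) :
  Fclass m B f -> (r < m)%N -> interior_cube x -> 0 < t < 1 ->
  is_derive t 1 (fun t => dpart (nseq r i) f (upd x i t))
    (dpart (nseq r.+1 i) f (upd x i t)).
Proof.
move=> [[_ fd _] _] rm xI tI.
have := fd i (nseq r i); rewrite size_nseq => /(_ rm (upd x i t)).
move=> /(_ (interior_cube_upd i xI tI)).
rewrite tnth_upd eqxx; under eq_fun do rewrite upd_upd.
move=> df; apply: DeriveDef => //.
rewrite /= /partial tnth_upd eqxx -derive1E.
by apply: (f_equal (fun h : R -> R => derive1 h t)); apply/funext => u; rewrite upd_upd.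
Qed.

(** Midpoints of the mesh of step 1/N: even the extreme nodes lie in the open interval, where
    derivatives are controlled. *)
Definition grid_node (R : realType) (N j : nat) : R := (j%:R + 2^-1) / N%:R.

Lemma grid_node_itv (R : realType) N j : (j < N)%N -> 0 < grid_node R N j < 1.
Proof.
move=> jN; have N0 : 0 < N%:R :> R by rewrite ltr0n (leq_trans _ jN).
apply/andP; split; first by rewrite divr_gt0// ltr_wpDl.
rewrite ltr_pdivrMr// mul1r (@lt_le_trans _ _ (j%:R + 1))//.
  by rewrite ltrD2l invf_lt1// ltr1n.
by rewrite natr1 ler_nat.
Qed.

Lemma grid_window (R : realType) (N k : nat) (x : R) :
  (0 < k <= N)%N -> 0 < x < 1 ->
  exists2 j, (j + k <= N)%N & j%:R / N%:R <= x <= (j + k)%:R / N%:R.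
Proof.
move=> /andP[k0 kN] /andP[x0 x1].
have N0 : 0 < N%:R :> R by rewrite ltr0n (leq_trans k0).
have xN0 : 0 <= x * N%:R by rewrite mulr_ge0// ltW.
have /andP[cx xc] := Num.Theory.truncn_itv xN0; set c := Num.truncn _ in cx xc.
have cN : (c < N)%N.
  by rewrite -(ltr_nat R) (le_lt_trans cx)// -[ltRHS]mul1r ltr_pM2r.
(* The window starts at the mesh interval containing x and is shifted left when it would pass the
   right end. *)
exists (minn c (N - k)); first by lia.
rewrite ler_pdivrMr// ler_pdivlMr//; apply/andP; split.
  by rewrite (le_trans _ cx)// ler_nat geq_minl.
by rewrite (le_trans (ltW xc))// ler_nat; lia.
Qed.

(** Induction on the number k of coordinates allowed off the grid. Freeing one more coordinate costs
    one application of [interpolation_bound] to f - g along the line in that direction: at its nodes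
    the point has one off-grid coordinate fewer, and the m-th derivative of f - g is at most 2 B. *)
Lemma agree_on_grid (R : realType) (m d : nat) : exists2 C : R, 0 <= C &
  forall (B : R) (N : nat) (f g : d.-tuple R -> R), 0 < B -> (0 < N)%N ->
    Fclass m B f -> Fclass m B g ->
    (forall x : d.-tuple R, (forall i, exists2 j, (j < N)%N & tnth x i = grid_node R N j) ->
       f x = g x) ->
    forall x, interior_cube x -> `|f x - g x| <= C * (B * N%:R^-1 ^+ m).
Proof.
(* The constant is the length of a window of 2^m mesh intervals, in units of the mesh size. *)
have [C C0 CP] := @interpolation_bound R m (2 ^ m)%:R (ler0n _ _).
have : forall k, (k <= d)%N -> exists2 K : R, 0 <= K &
  forall (B : R) (N : nat) (f g : d.-tuple R -> R), 0 < B -> (2 ^ m <= N)%N ->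
    Fclass m B f -> Fclass m B g ->
    (forall x : d.-tuple R, (forall i, exists2 j, (j < N)%N & tnth x i = grid_node R N j) ->
       f x = g x) ->
    forall x, interior_cube x ->
      (forall i : 'I_d, (k <= i)%N -> exists2 j, (j < N)%N & tnth x i = grid_node R N j) ->
      `|f x - g x| <= K * (B * N%:R^-1 ^+ m).
  elim=> [_|k IH kd].
    exists 0 => // B N f g B0 mN fB gB fg x xI xN.
    by rewrite fg ?subrr ?normr0 ?mul0r// => i; exact: xN.
  have [K K0 KP] := IH (ltnW kd).
  exists (C * (K + 2)); first by rewrite mulr_ge0// addr_ge0.
  move=> B N f g B0 mN fB gB fg x xI xN.
  have m0 : (0 < 2 ^ m)%N by rewrite expn_gt0.
  have N0 : 0 < N%:R :> R by rewrite ltr0n (leq_trans m0).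
  pose i := Ordinal kd.
  have [|j0 j0N /andP[xl xr]] := @grid_window R N (2 ^ m) (tnth x i) _ (xI i).
    by rewrite m0.
  have node_l j : (j0 <= j)%N -> j0%:R / N%:R <= grid_node R N j.
    move=> jj; rewrite /grid_node ler_pM2r ?invr_gt0//.
    by rewrite (@le_trans _ _ j%:R) ?ler_nat// lerDl invr_ge0.
  have node_r j : (j < j0 + 2 ^ m)%N -> grid_node R N j <= (j0 + 2 ^ m)%:R / N%:R.
    move=> jj; rewrite /grid_node ler_pM2r ?invr_gt0//.
    apply: (@le_trans _ _ j.+1%:R); last by rewrite ler_nat.
    by rewrite -[j.+1%:R]natr1 lerD2l invf_le1// ler1n.
  pose t j := grid_node R N (j0 + j).
  have tmono j k' : (j <= k')%N -> t j <= t k'.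
    by move=> jk; rewrite /t/grid_node ler_pM2r ?invr_gt0// lerD2r ler_nat leq_add2l.
  (* The hull of the point and the nodes of the window: unlike the window itself, it stays away from
     0 and 1. *)
  pose a := Num.min (tnth x i) (t 0%N).
  pose b := Num.max (tnth x i) (t (2 ^ m).-1).
  have tI j : (j < 2 ^ m)%N -> 0 < t j < 1.
    by move=> jm; apply: grid_node_itv; rewrite (leq_trans _ j0N)// ltn_add2l.
  have abI y : a <= y <= b -> 0 < y < 1.
    move=> /andP[ay yb]; have /andP[x0 x1] := xI i.
    have /andP[t0 _] := tI 0%N m0.
    have /andP[_ t1] : 0 < t (2 ^ m).-1 < 1 by apply: tI; rewrite prednK.
    by rewrite (lt_le_trans _ ay) ?(le_lt_trans yb)//= ?lt_min ?gt_max ?x0 ?x1 ?t0 ?t1.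
  pose D r y := dpart (nseq r i) f (upd x i y) - dpart (nseq r i) g (upd x i y).
  have e0 : 0 <= B * N%:R^-1 ^+ m.
    by rewrite mulr_ge0 ?ltW// exprn_gt0// invr_gt0.
  have : `|D 0%N (tnth x i)| <= C * (K * (B * N%:R^-1 ^+ m) + 2 * B * N%:R^-1 ^+ m).
    apply: (CP _ _ _ a b D t) => //.
    - by rewrite invr_gt0.
    - exact: mulr_ge0.
    - by rewrite mulr_ge0// ltW.
    - rewrite lerBlDr.
      apply: (@le_trans _ _ ((j0 + 2 ^ m)%:R / N%:R)).
        rewrite /b ge_max xr node_r// ltn_add2l prednK//.
      rewrite natrD mulrDl addrC lerD2l /a le_min xl node_l// leq_addr//.
    - move=> r y rm /abI yI; apply: is_deriveB.
        exact: (Fclass_is_derive _ fB).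
      exact: (Fclass_is_derive _ gB).
    - move=> y /abI yI; rewrite mulr_natl mulr2n (le_trans (ler_normB _ _))//.
      by rewrite lerD// (Fclass_dpart_le fB, Fclass_dpart_le gB) ?size_nseq//;
        exact: interior_cube_upd.
    - move=> j jm; split.
        rewrite /a /b ge_min le_max !tmono ?orbT// -ltnS prednK//.
      rewrite /D /=; apply: KP => //; first by apply: interior_cube_upd; rewrite ?tI.
      move=> i'; rewrite leq_eqVlt tnth_upd => /predU1P[ki|ki].
        have -> : i' = i by apply: val_inj.
        by rewrite eqxx; exists (j0 + j)%N => //; rewrite (leq_trans _ j0N)// ltn_add2l.
      case: eqP => [ii|_]; last exact: xN.
      by move: ki; rewrite ii ltnn.
    - by move=> j jm; rewrite /t /grid_node addnS -[(j0 + j).+1%:R]natr1; lra.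
    - by rewrite /a /b ge_min le_max lexx.
  rewrite /D /= upd_id; congr (_ <= _); ring.
move=> /(_ d (leqnn d))[K K0 KP].
(* The second summand serves N < 2^m, where no full window fits: there |f - g| <= 2 B, and N^(-m) is
   at least (2^m)^(-m). *)
exists (K + 2 * (2 ^ m)%:R ^+ m); first by rewrite addr_ge0// mulr_ge0// exprn_ge0.
move=> B N f g B0 N0 fB gB fg x xI.
have NR0 : 0 < N%:R :> R by rewrite ltr0n.
have BN : 0 <= B * N%:R^-1 ^+ m by rewrite mulr_ge0 ?ltW// exprn_gt0// invr_gt0.
have [mN|Nm] := leqP (2 ^ m) N.
  rewrite (@le_trans _ _ (K * (B * N%:R^-1 ^+ m)))//; last first.
    by rewrite ler_wpM2r// lerDl mulr_ge0// exprn_ge0.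
  by apply: KP => // i; rewrite leqNgt ltn_ord.
apply: (@le_trans _ _ (B + B)).
  rewrite (le_trans (ler_normB _ _))//.
  by rewrite lerD// (Fclass_le fB, Fclass_le gB)//; exact: interior_cube_sub.
have : 1 <= (2 ^ m)%:R ^+ m * N%:R^-1 ^+ m :> R.
  rewrite -exprMn exprn_ege1// ler_pdivlMr// mul1r ler_nat ltnW//.
have : 0 <= K * (B * N%:R^-1 ^+ m) by rewrite mulr_ge0.
rewrite mulrDl.
move: (_ ^+ m) (N%:R^-1 ^+ m) (K * _) => u v w w0 uv.
nra.
Qed.

(** * Measures with a density and Lebesgue measure on the cube *)

(** [mnormalize] supplies the structure of a probability; for total mass 1 it leaves the measure
    unchanged. *)
Lemma probability_of_measure (d : measure_display) (T : measurableType d) (R : realType)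
    (mu : {measure set T -> \bar R}) :
  mu setT = 1%E -> exists P : probability T R, forall A, P A = mu A.
Proof.
move=> mu1; exists (mnormalize mu (dirac point)) => A.
by rewrite /= /mnormalize mu1 onee_eq0/= invr1 mule1.
Qed.

Section density.
Context (d : measure_display) (T : measurableType d) (R : realType).
Variables (mu : {measure set T -> \bar R}) (q : T -> R).
Hypotheses (mq : measurable_fun setT q) (q0 : forall x, 0 <= q x).
Local Open Scope ereal_scope.

(** The two proofs are arguments so that the measure structure can be attached to the term
    itself. *)
Definition mdensity of measurable_fun setT q & (forall x, (0 <= q x)%R) : set T -> \bar R :=
  fun A => \int[mu]_(x in A) (q x)%:E.

Local Notation nu := (mdensity mq q0).

Let mdensity0 : nu set0 = 0.
Proof. by rewrite /mdensity integral_set0. Qed.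

Let mdensity_ge0 A : 0 <= nu A.
Proof. by apply: integral_ge0 => x _; rewrite lee_fin. Qed.

Let mdensity_sigma_additive : semi_sigma_additive nu.
Proof.
move=> F mF tF mUF; rewrite /mdensity; apply: cvg_toP.
  apply: ereal_nondecreasing_is_cvgn => m n mn.
  by apply: lee_sum_nneg_natr => // k _ _; exact: mdensity_ge0.
rewrite ge0_integral_bigcup//=.
- by apply/measurable_EFinP/measurable_funTS.
- by move=> x _; rewrite lee_fin.
Qed.

HB.instance Definition _ := isMeasure.Build _ _ _ nu
  mdensity0 mdensity_ge0 mdensity_sigma_additive.

Import HBNNSimple.

(** Both sides are monotone limits along simple functions below h; for a simple function they are
    the same finite sum over its values. *)
Lemma integral_mdensity (h : T -> \bar R) :
  measurable_fun setT h -> (forall x, 0 <= h x) ->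
  \int[nu]_x h x = \int[mu]_x (h x * (q x)%:E).
Proof.
move=> mh h0.
have mqE : measurable_fun setT (EFin \o q) by exact/measurable_EFinP.
pose h_ := nnsfun_approx measurableT mh.
have cvgh x : EFin \o h_ ^~ x @ \oo --> h x.
  by apply: cvg_nnsfun_approx => //= y _; exact: h0.
transitivity (limn (fun n => \int[nu]_x (h_ n x)%:E)).
  rewrite -monotone_convergence//.
  - by apply: eq_integral => x _; apply/esym/cvg_lim => //; exact: cvgh.
  - by move=> n; exact/measurable_EFinP.
  - by move=> n x _; rewrite lee_fin.
  - by move=> x _ a b ab; rewrite lee_fin; exact/lefP/nd_nnsfun_approx.
transitivity (limn (fun n => \int[mu]_x ((h_ n x)%:E * (q x)%:E))); last first.
  rewrite -monotone_convergence//.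
  - apply: eq_integral => x _; apply/cvg_lim => //.
    by apply: cvgeZr => //; exact: cvgh.
  - by move=> n; apply: emeasurable_funM => //; exact/measurable_EFinP.
  - by move=> n x _; rewrite mule_ge0 ?lee_fin.
  - move=> x _ a b ab; rewrite lee_wpmul2r ?lee_fin//.
    exact/lefP/nd_nnsfun_approx.
congr (limn _); apply/funext => n.
transitivity (\int[nu]_x (\sum_(y \in range (h_ n)) (y * \1_(h_ n @^-1` [set y]) x)%:E)).
  by apply: eq_integral => x _; rewrite fimfunE -fsumEFin.
transitivity (\int[mu]_x
   (\sum_(y \in range (h_ n)) (y * \1_(h_ n @^-1` [set y]) x)%:E * (q x)%:E)); last first.
  apply: eq_integral => x _; rewrite fimfunE -fsumEFin//.
  rewrite ge0_mule_fsuml// => y.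
  by rewrite nnfun_muleindic_ge0.
rewrite ge0_integral_fsum//; last 2 first.
- by move=> r; exact/measurable_EFinP/measurable_funM.
- by move=> r x _; rewrite nnfun_muleindic_ge0.
rewrite ge0_integral_fsum//; last 2 first.
- by move=> r; apply: emeasurable_funM => //; exact/measurable_EFinP/measurable_funM.
- by move=> r x _; rewrite mule_ge0 ?lee_fin// -lee_fin nnfun_muleindic_ge0.
apply: eq_fsbigr => r _.
rewrite integralZl_indic_nnsfun// integral_indic// setIT /=.
under [RHS]eq_integral do rewrite EFinM -muleA.
rewrite /mdensity.
have [r0|r0] := leP 0%R r; last first.
  rewrite preimage_nnfun0// integral_set0 mule0 integral0_eq// => x _.
  by rewrite indicE in_set0 mul0e mule0.
rewrite [RHS]ge0_integralZl//; last 2 first.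
- by apply: emeasurable_funM => //; exact/measurable_EFinP.
- by move=> x _; rewrite mule_ge0// lee_fin.
congr (_ * _); rewrite [LHS]integral_mkcond; apply: eq_integral => x _.
by rewrite patchE indicE; case: ifPn => _; rewrite ?mul1e ?mul0e.
Qed.

End density.

Section cube_measure.
Variable R : realType.

(** Functions of the class are unconstrained outside the cube; this lets them be replaced by their
    restriction to it. *)
Lemma iint_congr d (g h : d.-tuple R -> \bar R) :
  (forall x, cube x -> g x = h x) -> iint g = iint h.
Proof.
elim: d g h => [|d IH] g h gh /=; first by apply: gh => -[].
apply: eq_integral => x; rewrite inE/= in_itv/= => x01.
apply: IH => y yc; apply: gh => i.
by case: (unliftP ord0 i) => [j ->|->]; rewrite ?tnthS ?tnth0.
Qed.

(** Gives access to Lebesgue integration. In the inductive step the measure is the image under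
    [cons] of the product of the uniform law on [0,1] with the measure for d, and Tonelli's theorem
    unfolds it into iterated integrals. *)
Lemma iint_probability d : exists P : probability (d.-tuple R) R,
  forall g : d.-tuple R -> \bar R, measurable_fun setT g -> (forall x, 0 <= g x)%E ->
    iint g = (\int[P]_x g x)%E.
Proof.
elim: d => [|d [P PE]].
  exists (dirac [tuple]) => g mg g0 /=.
  by rewrite integral_dirac// diracT mul1e.
(* [R] and [measurableTypeR R] have the same measurable sets but different displays, and
   Lebesgue measure lives on the latter. *)
pose U : probability (measurableTypeR R) R := uniform_prob (@ltr01 R).
pose c (z : measurableTypeR R * d.-tuple R) : d.+1.-tuple R := [the d.+1.-tuple R of z.1 :: z.2].
have mc : measurable_fun setT c.
  apply: measurable_cons; last exact: measurable_snd.
  by move=> mT Y mY; exact: (@measurable_fst _ _ (measurableTypeR R) (d.-tuple R) mT Y mY).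
pose mu : {measure set (measurableTypeR R * d.-tuple R) -> \bar R} := (U \x P)%E.
pose nu : {measure set (d.+1.-tuple R) -> \bar R} := pushforward mu c.
have [|Q QE] := @probability_of_measure _ _ _ (nu mc).
  rewrite /nu /= /pushforward preimage_setT -setXTT product_measure1E//.
  transitivity (1 * 1 : \bar R)%E; last by rewrite mule1.
  by congr (_ * _)%E; [exact: (probability_setT U)|exact: (probability_setT P)].
exists Q => g mg g0 /=.
have mgc : measurable_fun setT (g \o c) by exact: measurableT_comp.
rewrite (eq_measure_integral (nu mc))//.
rewrite ge0_integral_pushforward// preimage_setT fubini_tonelli1//=.
rewrite integral_uniform//; last 2 first.
- apply: (measurable_fun_fubini_tonelli_F (g \o c)) => // x; exact: g0.
- by move=> x; apply: integral_ge0 => y _; exact: g0.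
- rewrite subr0 invr1 mul1e; apply: eq_integral => x _.
  rewrite PE//.
  apply: (measurableT_comp mg); apply: measurable_cons => //.
- by move=> A _ _; exact: QE.
Qed.

Definition cube_prob d : probability (d.-tuple R) R := sval (cid (iint_probability d)).

Lemma iintE d (g : d.-tuple R -> \bar R) :
  measurable_fun setT g -> (forall x, 0 <= g x)%E -> iint g = (\int[cube_prob d]_x g x)%E.
Proof. by rewrite /cube_prob; case: cid => P PE; exact: PE. Qed.

Lemma measurable_cube d : measurable (@cube R d).
Proof.
have -> : @cube R d = \bigcap_(i in [set: 'I_d]) ((fun x => tnth x i) @^-1` `[0, 1]).
  apply/seteqP; split => x /= xc i; first by move=> _ /=; rewrite in_itv/=; exact: xc.
  by have := xc i I; rewrite /= in_itv.
apply: fin_bigcap_measurable => // i _.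
by rewrite -[X in measurable X]setTI; apply: measurable_tnth.
Qed.

(** On the cube f is the pointwise limit of step functions that sample it at the point of the mesh
    1/(n+1) just below x in every coordinate. *)
Lemma measurable_cont_on_cube d (f : d.-tuple R -> R) :
  cont_on_cube f -> measurable_fun (@cube R d) f.
Proof.
move=> cf.
(* The index runs up to n + 1 included, because a coordinate equal to 1 is itself a mesh point. *)
pose y n (k : {ffun 'I_d -> 'I_n.+2}) : d.-tuple R := [tuple (k i)%:R / n.+1%:R | i < d].
pose h n (x : d.-tuple R) : R := \sum_(k : {ffun 'I_d -> 'I_n.+2}) f (y n k) *
  \prod_(i < d) (if (k i)%:R <= n.+1%:R * tnth x i < (k i).+1%:R then 1 else 0).
apply: (@measurable_fun_cvg _ _ _ _ h).
  move=> n; apply/measurable_funTS; apply: measurable_sum => k.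
  apply: measurable_funM => //; apply: measurable_prod => i _.
  have mx : measurable_fun setT (fun x : d.-tuple R => n.+1%:R * tnth x i).
    by apply: measurable_funM => //; exact: measurable_tnth.
  apply: measurable_fun_ifT => //; apply: measurable_and.
    exact: measurable_fun_ler.
  exact: measurable_fun_ltr.
move=> x xc.
pose k n : {ffun 'I_d -> 'I_n.+2} := [ffun i => inord (Num.truncn (n.+1%:R * tnth x i))].
have x0 n i : 0 <= n.+1%:R * tnth x i by have /andP[? _] := xc i; rewrite mulr_ge0.
have kE n i : k n i = Num.truncn (n.+1%:R * tnth x i) :> nat.
  rewrite ffunE inordK// ltnS -(ler_nat R).
  apply: (@le_trans _ _ (n.+1%:R * tnth x i)); first by rewrite Num.Theory.truncn_le.
  rewrite ler_piMr//.
  by have /andP[] := xc i.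
have kx n i : (k n i)%:R <= n.+1%:R * tnth x i < (k n i).+1%:R.
  by rewrite !kE Num.Theory.truncn_itv.
have hE n : h n x = f (y n (k n)).
  rewrite /h (bigD1 (k n))//= [X in _ * X]big1 ?mulr1; last by move=> i _; rewrite kx.
  rewrite big1 ?addr0// => k' k'k.
  have [i ki] : exists i, k' i != k n i.
    apply/existsP; rewrite -negb_forall; apply: contra k'k => /forallP kk.
    by apply/eqP/ffunP => i; exact/eqP.
  rewrite (bigD1 i)//= ifF ?mul0r ?mulr0//.
  apply: contraNF ki => k'x; apply/eqP/val_inj => /=.
  by rewrite kE; apply/esym/Num.Theory.truncn_def.
under eq_fun do rewrite hE.
apply/cvgrPdist_lt => e e0.
have [dl dl0 fdl] := cf x xc e e0.
near=> n.
rewrite distrC; apply: fdl => i; rewrite tnth_mktuple.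
  have /andP[kl _] := kx n i; have /andP[_ x1] := xc i.
  rewrite divr_ge0//= ler_pdivrMr// mul1r (le_trans kl)//.
  by rewrite ler_piMr.
have /andP[kl kr] := kx n i.
have n0 : 0 < n.+1%:R :> R by [].
have nd : n.+1%:R^-1 < dl by near: n; exact: near_infty_natSinv_lt (PosNum dl0).
apply: le_lt_trans nd.
rewrite -(ler_pM2r n0) mulVf// -[X in _ * X]gtr0_norm// -normrM mulrBl divfK//.
rewrite distrC ger0_norm ?subr_ge0 ?[_ * n.+1%:R]mulrC// lerBlDl.
by rewrite natr1 ltW.
Unshelve. all: end_near. Qed.

End cube_measure.

(** * Gibbs measures *)

Section gibbs.
Variables (R : realType) (d : nat).
Implicit Types (f g : d.-tuple R -> R) (B e : R).
Local Notation lam := (cube_prob R d).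
Local Notation Qb := (@cube R d).

Definition bounded_cont B f := cont_on_cube f /\ forall x, cube x -> `|f x| <= B.

Lemma restrict_cube f x : cube x -> (f \_ Qb) x = f x.
Proof. by move=> xc; rewrite patchE mem_set. Qed.

Lemma measurable_restrict_cube f : cont_on_cube f -> measurable_fun setT (f \_ Qb).
Proof.
move=> cf; apply/(measurable_restrictT _ (@measurable_cube R d)).
exact: measurable_cont_on_cube.
Qed.

Lemma measurable_expR_restrict f : cont_on_cube f ->
  measurable_fun setT (fun x => expR ((f \_ Qb) x)).
Proof. by move=> /measurable_restrict_cube mf; exact: measurableT_comp. Qed.

Lemma restrict_cube_le B f x : 0 <= B -> (forall y, cube y -> `|f y| <= B) ->
  `|(f \_ Qb) x| <= B.
Proof.
move=> B0 fB; rewrite patchE; case: ifPn => [/[!inE] xc|_]; first exact: fB.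
by rewrite normr0.
Qed.

Lemma integral_expR_restrict_itv B f : 0 <= B -> bounded_cont B f ->
  ((expR (- B))%:E <= \int[lam]_x (expR ((f \_ Qb) x))%:E <= (expR B)%:E)%E.
Proof.
move=> B0 [cf fB].
have mE : measurable_fun setT (fun x => (expR ((f \_ Qb) x))%:E).
  by apply/measurable_EFinP; exact: measurable_expR_restrict.
have cstE c : (\int[lam]_x (expR c)%:E = (expR c)%:E)%E.
  by rewrite integral_cst//= probability_setT mule1.
have fx x := restrict_cube_le x B0 fB.
apply/andP; split.
  rewrite -(cstE (- B)); apply: ge0_le_integral => //.
  move=> x _; rewrite lee_fin ler_expR.
  by have := fx x; rewrite ler_norml => /andP[].
rewrite -[leRHS]cstE; apply: ge0_le_integral => //.
move=> x _; rewrite lee_fin ler_expR.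
by have := fx x; rewrite ler_norml => /andP[].
Qed.

Lemma Zf_integral B f : 0 <= B -> bounded_cont B f ->
  (\int[lam]_x (expR ((f \_ Qb) x))%:E)%E = (Zf f)%:E.
Proof.
move=> B0 fB; rewrite /Zf.
rewrite (@iint_congr _ _ _ (fun x => (expR ((f \_ Qb) x))%:E)); last first.
  by move=> x xc; rewrite restrict_cube.
rewrite iintE; last 2 first.
- by apply/measurable_EFinP; apply: measurable_expR_restrict; case: fB.
- by move=> x; rewrite lee_fin expR_ge0.
rewrite fineK// ge0_fin_numE.
  by have /andP[_] := integral_expR_restrict_itv B0 fB => /le_lt_trans ->//; exact: ltry.
by apply: integral_ge0 => x _; rewrite lee_fin expR_ge0.
Qed.

Lemma Zf_itv B f : 0 <= B -> bounded_cont B f -> expR (- B) <= Zf f <= expR B.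
Proof.
move=> B0 fB; have := integral_expR_restrict_itv B0 fB.
by rewrite (Zf_integral B0 fB) !lee_fin.
Qed.

Lemma Zf_gt0 B f : 0 <= B -> bounded_cont B f -> 0 < Zf f.
Proof. by move=> B0 /(Zf_itv B0)/andP[+ _]; apply: lt_le_trans; exact: expR_gt0. Qed.

(** The restriction makes it measurable on the whole space. Outside the cube it takes the value 1 /
    Z_f, which integrals against [cube_prob] do not see. *)
Definition gibbs_pdf f (x : d.-tuple R) : R := expR ((f \_ Qb) x) / Zf f.

Lemma gibbs_pdf_ge0 B f x : 0 <= B -> bounded_cont B f -> 0 <= gibbs_pdf f x.
Proof. by move=> B0 fB; rewrite divr_ge0 ?expR_ge0// ltW// (Zf_gt0 B0). Qed.

Lemma measurable_gibbs_pdf f : cont_on_cube f -> measurable_fun setT (gibbs_pdf f).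
Proof. by move=> cf; apply: measurable_funM => //; exact: measurable_expR_restrict. Qed.

Lemma PfE B f A : 0 <= B -> bounded_cont B f -> measurable A ->
  Pf f A = (\int[lam]_x ((\1_A x)%:E * (gibbs_pdf f x)%:E))%E.
Proof.
move=> B0 fB mA; have Z0 := Zf_gt0 B0 fB; rewrite /Pf.
rewrite (@iint_congr _ _ _ (fun x => (\1_A x * expR ((f \_ Qb) x))%:E)); last first.
  by move=> x xc; rewrite restrict_cube.
have m1 : measurable_fun setT (fun x => (\1_A x * expR ((f \_ Qb) x))%:E).
  apply/measurable_EFinP/measurable_funM => //.
  by apply: measurable_expR_restrict; case: fB.
have p1 x : (0 <= (\1_A x * expR ((f \_ Qb) x))%:E)%E.
  by rewrite lee_fin mulr_ge0 ?expR_ge0.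
rewrite iintE//.
rewrite -ge0_integralZr//; last by rewrite lee_fin invr_ge0 ltW.
by apply: eq_integral => x _; rewrite -!EFinM mulrA.
Qed.

(** [Pf f] is only a set function built from iterated integrals; here it is realised by a
    probability, for which integrals and couplings make sense. *)
Lemma gibbs_probability B f : 0 <= B -> bounded_cont B f ->
  exists Q : probability (d.-tuple R) R,
  [/\ distr_on_cube Q, forall A, measurable A -> Pf f A = Q A &
      forall h : d.-tuple R -> \bar R, measurable_fun setT h -> (forall x, 0 <= h x)%E ->
        (\int[Q]_x h x = \int[lam]_x (h x * (gibbs_pdf f x)%:E))%E].
Proof.
move=> B0 fB; have [cf _] := fB; have Z0 := Zf_gt0 B0 fB.
have mp := measurable_gibbs_pdf cf.
have p0 x : 0 <= gibbs_pdf f x by exact: gibbs_pdf_ge0 B0 fB.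
pose nu : {measure set (d.-tuple R) -> \bar R} := mdensity lam mp p0.
have nuE A : measurable A -> nu A = Pf f A.
  move=> mA; rewrite (PfE B0 fB mA) -(integral_mdensity lam mp p0)//.
  - by rewrite integral_indic// setIT.
  - by apply/measurable_EFinP; exact: measurable_indic.
have PfT A : (forall x, cube x -> A x) -> Pf f A = 1%E.
  move=> AC; rewrite /Pf (@iint_congr _ _ _ (fun x => (expR ((f \_ Qb) x))%:E)); last first.
    by move=> x xc; rewrite restrict_cube// indicE mem_set ?mul1r//; exact: AC.
  rewrite iintE; last 2 first.
  - by apply/measurable_EFinP; exact: measurable_expR_restrict.
  - by move=> x; rewrite lee_fin expR_ge0.
  by rewrite (Zf_integral B0 fB) -EFinM divff ?gt_eqF.
have [|Q QE] := @probability_of_measure _ _ _ nu.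
  by rewrite nuE// PfT.
exists Q; split => [|A mA|h mh h0].
- rewrite /distr_on_cube QE nuE ?PfT//; exact: measurable_cube.
- by rewrite QE nuE.
- rewrite (eq_measure_integral nu); first exact: integral_mdensity.
  by move=> A _ _; exact: QE.
Qed.

End gibbs.

(** * Sup-norm perturbations *)

Lemma eucl_ge0 (R : realType) d (x y : d.-tuple R) : 0 <= eucl x y.
Proof. exact: sqrtr_ge0. Qed.

Lemma eucl_le (R : realType) d (x y : d.-tuple R) : cube x -> cube y -> eucl x y <= Num.sqrt d%:R.
Proof.
move=> xc yc; apply: ler_wsqrtr.
apply: (@le_trans _ _ (\sum_(i < d) 1)); last by rewrite sumr_const card_ord.
apply: ler_sum => i _; have := xc i; have := yc i.
move: (tnth x i) (tnth y i) => a b /andP[? ?] /andP[? ?]; nra.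
Qed.

Lemma measurable_eucl (R : realType) d :
  measurable_fun setT (fun z : d.-tuple R * d.-tuple R => eucl z.1 z.2).
Proof.
apply: (@measurableT_comp _ _ _ _ _ _ (@Num.sqrt R)).
  by apply: continuous_measurable_fun; exact: sqrt_continuous.
apply: measurable_sum => i; apply: measurable_funX; apply: measurable_funB.
  exact: (measurableT_comp (measurable_tnth i) measurable_fst).
exact: (measurableT_comp (measurable_tnth i) measurable_snd).
Qed.

Section comparison.
Variables (R : realType) (d : nat) (B e : R) (f g : d.-tuple R -> R).
Hypotheses (B0 : 0 <= B) (e0 : 0 <= e) (fB : bounded_cont B f) (gB : bounded_cont B g).
Hypothesis fg : forall x, cube x -> `|f x - g x| <= e.
Local Notation lam := (cube_prob R d).
Local Notation Qb := (@cube R d).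

Lemma restrict_cube_dist x : `|(f \_ Qb) x - (g \_ Qb) x| <= e.
Proof.
rewrite !patchE; case: ifPn => [/[!inE] xc|_]; first exact: fg.
by rewrite subrr normr0.
Qed.

Lemma Zf_le : Zf f <= expR e * Zf g.
Proof.
rewrite -lee_fin EFinM -(Zf_integral B0 fB) -(Zf_integral B0 gB).
have [[cf _] [cg _]] := (fB, gB).
rewrite -ge0_integralZl//; last first.
  by apply/measurable_EFinP; exact: measurable_expR_restrict.
apply: ge0_le_integral => //.
- by apply/measurable_EFinP; exact: measurable_expR_restrict.
- apply/measurable_EFinP; apply: measurable_funM => //.
  exact: measurable_expR_restrict.
- move=> x _; rewrite -EFinM lee_fin -expRD ler_expR -lerBlDr.
  exact: (le_trans (ler_norm _) (restrict_cube_dist x)).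
Qed.

End comparison.

Section distances.
Variables (R : realType) (d : nat) (B e : R) (f g : d.-tuple R -> R).
Hypotheses (B0 : 0 <= B) (e0 : 0 <= e) (fB : bounded_cont B f) (gB : bounded_cont B g).
Hypothesis fg : forall x, cube x -> `|f x - g x| <= e.
Local Notation lam := (cube_prob R d).
Local Notation Qb := (@cube R d).

Let gf x : cube x -> `|g x - f x| <= e.
Proof. by rewrite distrC; exact: fg. Qed.

Lemma Lf_dist : `|Lf f - Lf g| <= e.
Proof.
have [Zf0 Zg0] := (Zf_gt0 B0 fB, Zf_gt0 B0 gB).
have L (h k : d.-tuple R -> R) : 0 < Zf h -> 0 < Zf k ->
    Zf h <= expR e * Zf k -> Lf h - Lf k <= e.
  move=> h0 k0 hk; rewrite lerBlDr /Lf -[e in leRHS]expRK.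
  by rewrite -lnM ?posrE ?expR_gt0// ler_ln ?posrE// mulr_gt0// expR_gt0.
rewrite ler_norml lerNl opprB !L//; exact: (@Zf_le R d B).
Qed.

(** One e comes from the exponent, the other from the ratio of the normalising constants. *)
Lemma gibbs_pdf_le x : gibbs_pdf f x <= expR (2 * e) * gibbs_pdf g x.
Proof.
have [Zf0 Zg0] := (Zf_gt0 B0 fB, Zf_gt0 B0 gB).
have Zgf := Zf_le B0 e0 gB fB gf.
rewrite /gibbs_pdf mulrA ler_pdivrMr// mulrAC ler_pdivlMr//.
have -> : 2 * e = e + e by rewrite mulr_natl mulr2n.
have FG : expR ((f \_ Qb) x) <= expR e * expR ((g \_ Qb) x).
  rewrite -expRD ler_expR -lerBlDr.
  exact: (le_trans (ler_norm _) (restrict_cube_dist e0 fg x)).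
apply: le_trans (ler_pM _ _ FG Zgf) _; rewrite ?expR_ge0 ?(ltW Zg0)//.
by rewrite expRD le_eqVlt; apply/orP; left; apply/eqP; ring.
Qed.

Lemma Pf_le A : measurable A -> (Pf f A <= (expR (2 * e))%:E * Pf g A)%E.
Proof.
move=> mA; have [[cf _] [cg _]] := (fB, gB).
have m h : cont_on_cube h ->
    measurable_fun setT (fun x => (\1_A x)%:E * (gibbs_pdf h x)%:E : \bar R)%E.
  move=> ch; apply: emeasurable_funM; apply/measurable_EFinP => //.
  exact: measurable_gibbs_pdf.
have p0 h : bounded_cont B h -> forall x, setT x ->
    (0 <= (\1_A x)%:E * (gibbs_pdf h x)%:E :> \bar R)%E.
  by move=> hB x _; rewrite -EFinM lee_fin mulr_ge0// (gibbs_pdf_ge0 _ B0).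
rewrite (PfE B0 fB mA) (PfE B0 gB mA) -ge0_integralZl//; last 2 first.
- exact: m.
- exact: p0.
apply: ge0_le_integral => //.
- exact: p0.
- exact: m.
- by apply: measurable_funeM; exact: m.
- move=> x _; rewrite muleCA lee_wpmul2l ?lee_fin// -?EFinM ?lee_fin.
  exact: gibbs_pdf_le.
Qed.

End distances.

Section upper.
Variables (R : realType) (d : nat) (B e : R) (f g : d.-tuple R -> R).
Hypotheses (B0 : 0 <= B) (e0 : 0 <= e) (fB : bounded_cont B f) (gB : bounded_cont B g).
Hypothesis fg : forall x, cube x -> `|f x - g x| <= e.
Variable Q : probability (d.-tuple R) R.
Hypotheses (Qcube : distr_on_cube Q) (QE : forall A, measurable A -> Pf g A = Q A).
Hypothesis integralQ : forall h : d.-tuple R -> \bar R,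
  measurable_fun setT h -> (forall x, 0 <= h x)%E ->
  (\int[Q]_x h x = \int[cube_prob R d]_x (h x * (gibbs_pdf g x)%:E))%E.
Local Notation lam := (cube_prob R d).
Local Notation Qb := (@cube R d).

Let gf x : cube x -> `|g x - f x| <= e.
Proof. by rewrite distrC; exact: fg. Qed.

Lemma D_suplog_le : (D_suplog (Pf f) Q <= (2 * e)%:E)%E.
Proof.
have [Zf0 Zg0] := (Zf_gt0 B0 fB, Zf_gt0 B0 gB).
have [[cf _] [cg _]] := (fB, gB).
(* The density of P_f with respect to P_g, in a form that is positive and measurable on the whole
   space. *)
pose h x := expR ((f \_ Qb) x - (g \_ Qb) x) * (Zf g / Zf f).
have h0 x : 0 < h x by rewrite mulr_gt0 ?expR_gt0// divr_gt0.
have mh : measurable_fun setT h.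
  apply: measurable_funM => //; apply: measurableT_comp => //.
  by apply: measurable_funB; exact: measurable_restrict_cube.
apply: (@le_trans _ _ (ess_sup Q (fun x => (`|ln (h x)|)%:E))).
  apply: ereal_inf_lbound; exists h; split => // A mA.
  rewrite integral_mkcond.
  transitivity (\int[Q]_x ((\1_A x)%:E * (h x)%:E))%E; last first.
    apply: eq_integral => x _; rewrite patchE indicE.
    by case: ifPn; rewrite ?mul1e ?mul0e.
  rewrite integralQ; last 2 first.
  - by apply: emeasurable_funM; apply/measurable_EFinP.
  - by move=> x; rewrite -EFinM lee_fin mulr_ge0// ltW.
  rewrite (PfE B0 fB mA); apply: eq_integral => x _; rewrite -muleA; congr (_ * _)%E.
  rewrite -EFinM /h /gibbs_pdf expRB; congr EFin; field.
  by rewrite !gt_eqF// expR_gt0.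
apply/ess_supP; apply: nearW => x; rewrite lee_fin /h.
rewrite lnM ?posrE ?expR_gt0 ?divr_gt0// expRK.
rewrite ln_div ?posrE//.
rewrite (le_trans (ler_normD _ _))// mulr_natl mulr2n lerD//.
  exact: restrict_cube_dist.
exact: (@Lf_dist R d B).
Qed.

(** Masses a, b in [0,1] with a <= K b and b <= K a satisfy |a - b| <= 1 - 1/K, because a - b <= a
    (1 - 1/K) and symmetrically. *)
Lemma D_TV_le : (D_TV (Pf f) Q <= (1 - expR (- (2 * e)))%:E)%E.
Proof.
apply: ge_ereal_sup => _ [A mA <-].
have [P [_ PE _]] := gibbs_probability B0 fB.
have := Pf_le B0 e0 fB gB fg mA; have := Pf_le B0 e0 gB fB gf mA.
rewrite (QE mA) (PE A mA).
have := probability_le1 P mA; have := probability_le1 Q mA.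
have := measure_ge0 P A; have := measure_ge0 Q A.
have [a ->] : exists a, P A = a%:E.
  by exists (fine (P A)); rewrite fineK// fin_num_measure.
have [b ->] : exists b, Q A = b%:E.
  by exists (fine (Q A)); rewrite fineK// fin_num_measure.
rewrite -!EFinM -EFinB abse_EFin !lee_fin expRN => b0 a0 b1 a1.
have K0 := expR_gt0 (2 * e); have : 1 <= expR (2 * e) by rewrite -expR0 ler_expR mulr_ge0.
move: (expR _) K0 => K K0 K1 ba ab.
have k1 : K^-1 <= 1 by rewrite invf_le1.
have ka : K^-1 * a <= b by rewrite mulrC ler_pdivrMr// mulrC.
have kb : K^-1 * b <= a by rewrite mulrC ler_pdivrMr// mulrC.
rewrite ler_norml; apply/andP; split; nra.
Qed.

(* The coupling is k diag(P_g) + (P_f - k P_g) x P_g with k = exp(-2e). *)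
Lemma W1_le : (W1 (Pf f) Q <= (Num.sqrt d%:R * (1 - expR (- (2 * e))))%:E)%E.
Proof.
have [[cf _] [cg _]] := (fB, gB).
pose k := expR (- (2 * e)).
have k0 : 0 <= k by exact: expR_ge0.
pose r x := gibbs_pdf f x - k * gibbs_pdf g x.
have mr : measurable_fun setT r.
  apply: measurable_funB; first exact: measurable_gibbs_pdf.
  by apply: measurable_funM => //; exact: measurable_gibbs_pdf.
have r0 x : 0 <= r x.
  rewrite subr_ge0 /k expRN ler_pdivrMl ?expR_gt0//.
  exact: (gibbs_pdf_le B0 e0 gB fB gf).
pose nu : {measure set (d.-tuple R) -> \bar R} := mdensity lam mr r0.
have nuE A : measurable A -> (k%:E * Q A + nu A = Pf f A)%E.
  move=> mA; rewrite -QE// (PfE B0 fB mA) (PfE B0 gB mA).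
  have mA1 : measurable_fun setT (fun x : d.-tuple R => (\1_A x)%:E : \bar R).
    by apply/measurable_EFinP; exact: measurable_indic.
  have -> : nu A = (\int[lam]_x ((\1_A x)%:E * (r x)%:E))%E.
    rewrite -(integral_mdensity lam mr r0)//.
    by rewrite integral_indic// setIT.
  have m1 : measurable_fun setT (fun x => (\1_A x)%:E * (gibbs_pdf g x)%:E : \bar R)%E.
    apply: emeasurable_funM => //; apply/measurable_EFinP.
    exact: measurable_gibbs_pdf.
  have p1 x : setT x -> (0 <= (\1_A x)%:E * (gibbs_pdf g x)%:E :> \bar R)%E.
    by move=> _; rewrite -EFinM lee_fin mulr_ge0// (gibbs_pdf_ge0 _ B0).
  have m2 : measurable_fun setT (fun x => (\1_A x)%:E * (r x)%:E : \bar R)%E.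
    by apply: emeasurable_funM => //; exact/measurable_EFinP.
  have p2 x : setT x -> (0 <= (\1_A x)%:E * (r x)%:E :> \bar R)%E.
    by move=> _; rewrite -EFinM lee_fin mulr_ge0.
  have m3 := measurable_funeM k%:E m1.
  have p3 x : setT x -> (0 <= k%:E * ((\1_A x)%:E * (gibbs_pdf g x)%:E))%E.
    by move=> xT; rewrite mule_ge0// p1.
  rewrite -(@ge0_integralZl _ _ _ lam setT measurableT _ m1 k%:E p1)//.
  rewrite -(@ge0_integralD _ _ _ lam setT measurableT _ _ p3 m3 p2 m2).
  apply: eq_integral => x _; rewrite -!EFinM -EFinD; congr EFin; rewrite /r; ring.
have [P [Pcube PE _]] := gibbs_probability B0 fB.
have nuT : nu setT = (1 - k)%:E.
  have := nuE setT measurableT; rewrite PE// !probability_setT mule1 => H.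
  by rewrite EFinB -[1%:E]H addeAC subee// add0e.
(* The cost is bounded by sqrt d only on the cube, so the complement must be negligible for both
   factors of the product part. *)
have nuC : nu (~` Qb) = 0%E.
  have mC : measurable (~` Qb) by apply: measurableC; exact: measurable_cube.
  apply/eqP; rewrite -measure_le0; apply: (@le_trans _ _ (P (~` Qb))).
    by rewrite -PE// -nuE// leeDr// mule_ge0.
  by rewrite probability_setC ?Pcube ?subee//; exact: measurable_cube.
have QC : Q (~` Qb) = 0%E.
  by rewrite probability_setC ?Qcube ?subee//; exact: measurable_cube.
pose dg (x : d.-tuple R) := (x, x).
have mdg : measurable_fun setT dg by apply: measurable_fun_pair.
pose p1 : {measure set (d.-tuple R * d.-tuple R) -> \bar R} :=
  mscale (NngNum k0) (pushforward Q dg).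
pose p2 : {measure set (d.-tuple R * d.-tuple R) -> \bar R} := (nu \x Q)%E.
(* The first marginal is k P_g + nu = P_f; the second is k P_g + (1 - k) P_g, since nu has mass 1 -
   k. *)
pose p : {measure set (d.-tuple R * d.-tuple R) -> \bar R} := measure_add (p1 mdg) p2.
have pE A C : measurable A -> measurable C ->
    p (A `*` C) = (k%:E * Q (A `&` C) + nu A * Q C)%E.
  move=> mA mC; transitivity (p1 mdg (A `*` C) + p2 (A `*` C))%E.
    exact: measure_addE.
  by congr (_ + _)%E; exact: product_measure1E.
have pT : p setT = 1%E.
  by rewrite -setXTT pE// setIT !probability_setT nuT !mule1 -EFinD addrC subrK.
have [pi piE] := probability_of_measure pT.
apply: (@le_trans _ _ (\int[pi]_z (eucl z.1 z.2)%:E)%E).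
  apply: ereal_inf_lbound; exists pi; split => // A mA; rewrite piE pE//.
    by rewrite setIT probability_setT mule1 nuE.
  rewrite setTI nuT -[Q A]fineK ?fin_num_measure//.
  by rewrite -!EFinM -EFinD -mulrDl addrC subrK mul1r.
rewrite (eq_measure_integral p); last by move=> A _ _; exact: piE.
have mE : measurable_fun setT (fun z : d.-tuple R * d.-tuple R => (eucl z.1 z.2)%:E).
  by apply/measurable_EFinP; exact: measurable_eucl.
have E0 (z : d.-tuple R * d.-tuple R) : (0 <= (eucl z.1 z.2)%:E)%E.
  by rewrite lee_fin eucl_ge0.
rewrite ge0_integral_measure_add// ge0_integral_mscale//.
rewrite ge0_integral_pushforward// preimage_setT integral0_eq ?mule0 ?add0e; last first.
  move=> x _ /=; rewrite /eucl big1 ?sqrtr0// => i _.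
  by rewrite subrr expr0n.
apply: (@le_trans _ _ (\int[p2]_z (Num.sqrt d%:R)%:E)%E).
  apply: ae_ge0_le_integral => //.
  have mC : measurable (~` Qb) by apply: measurableC; exact: measurable_cube.
  have N1 : p2 (~` Qb `*` setT) = 0%E.
    transitivity (nu (~` Qb) * Q setT)%E; first exact: product_measure1E.
    by rewrite nuC mul0e.
  have N2 : p2 (setT `*` ~` Qb) = 0%E.
    transitivity (nu setT * Q (~` Qb))%E; first exact: product_measure1E.
    by rewrite QC mule0.
  have [mN1 mN2] : measurable (~` Qb `*` [set: d.-tuple R]) /\
      measurable ([set: d.-tuple R] `*` ~` Qb) by split; exact: measurableX.
  exists ((~` Qb `*` setT) `|` (setT `*` ~` Qb)); split.
  - exact: measurableU.
  - by rewrite measureU0.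
  - move=> [x y] /= H; apply: contrapT => /not_orP[/= /not_andP xc /not_andP yc].
    apply: H => _; rewrite lee_fin; apply: eucl_le.
      by case: xc => // /contrapT.
    by case: yc => // /contrapT.
rewrite integral_cst//; have -> : p2 setT = (1 - k)%:E; last by rewrite -EFinM.
rewrite -setXTT; transitivity (nu setT * Q setT)%E; first exact: product_measure1E.
by rewrite nuT probability_setT mule1.
Qed.

End upper.

(** * Test sets and test functions *)

Section product_integral.
Variable R : realType.

(** Tonelli for products of functions of one coordinate; it evaluates the volume of half-spaces and
    of the boxes under the bumps. *)
Lemma iint_prod d (u : 'I_d -> R -> R) (c : 'I_d -> R) :
  (forall i, measurable_fun setT (u i)) -> (forall i x, 0 <= u i x) ->
  (forall i, \int[@lebesgue_measure R]_(x in `[0%R, 1%R]) (u i x)%:E = (c i)%:E)%E ->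
  iint (fun x : d.-tuple R => (\prod_i u i (tnth x i))%:E) = (\prod_i c i)%:E.
Proof.
elim: d u c => [|d IH] u c mu u0 uc /=; first by rewrite !big_ord0.
pose v i := u (lift ord0 i).
rewrite big_ord_recl EFinM -uc.
under eq_integral => x _.
  rewrite (@iint_congr _ _ _
    (fun t => (u ord0 x)%:E * (\prod_i v i (tnth t i))%:E)%E); last first.
    move=> t _; rewrite big_ord_recl tnth0 EFinM; congr (_ * (_)%:E)%E.
    by apply: eq_bigr => i _; rewrite tnthS.
  rewrite iintE; last 2 first.
  - apply: measurable_funeM; apply/measurable_EFinP; apply: measurable_prod => i _.
    exact: (measurableT_comp (mu _) (measurable_tnth i)).
  - by move=> t; rewrite -EFinM lee_fin mulr_ge0// prodr_ge0// => i _; exact: u0.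
  have mv : measurable_fun setT (fun t : d.-tuple R => (\prod_i v i (tnth t i))%:E).
    apply/measurable_EFinP; apply: measurable_prod => i _.
    exact: (measurableT_comp (mu _) (measurable_tnth i)).
  have v0 (t : d.-tuple R) : (0 <= (\prod_i v i (tnth t i))%:E)%E.
    by rewrite lee_fin prodr_ge0// => i _; exact: u0.
  rewrite ge0_integralZl// ?lee_fin// -iintE// (IH v (fun i => c (lift ord0 i))).
  over.
- by move=> i; exact: mu.
- by move=> i y; exact: u0.
- by move=> i; exact: uc.
rewrite ge0_integralZr//.
- apply/measurable_EFinP; apply: measurable_funTS. exact: mu.
- by move=> x _; rewrite lee_fin.
- rewrite lee_fin prodr_ge0// => i _; rewrite -lee_fin -uc.
  by apply: integral_ge0 => x _; rewrite lee_fin.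
Qed.

Lemma measurable_half_space d (i : 'I_d) (s : R) :
  measurable [set x : d.-tuple R | s <= tnth x i].
Proof.
have mH : measurable_fun setT (fun x : d.-tuple R => s <= tnth x i).
  by apply: measurable_fun_ler => //; exact: measurable_tnth.
by rewrite -[X in measurable X]setTI; exact: (mH measurableT [set true]).
Qed.

Lemma cube_prob_half_space d (i : 'I_d) (s : R) : 0 <= s <= 1 ->
  cube_prob R d [set x | s <= tnth x i] = (1 - s)%:E.
Proof.
move=> /andP[s0 s1]; set A := [set x : d.-tuple R | s <= tnth x i].
have mA : measurable A by exact: measurable_half_space.
have := integral_indic (cube_prob R d) measurableT mA; rewrite setIT => <-.
rewrite -iintE; last 2 first.
- by apply/measurable_EFinP; exact: measurable_indic.
- by move=> x; rewrite lee_fin.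
pose u (j : 'I_d) (x : R) : R := if j == i then \1_(`[s, 1]) x else 1.
rewrite (@iint_congr _ _ _ (fun x => (\prod_j u j (tnth x j))%:E)); last first.
  move=> x xc; congr EFin; rewrite (bigD1 i)//= big1 ?mulr1; last first.
    by move=> j ji; rewrite /u (negbTE ji).
  rewrite /u eqxx !indicE; congr (_ %:R); congr nat_of_bool; apply/idP/idP.
    by rewrite !inE /A/= in_itv/= => ->; have /andP[] := xc i.
  by rewrite !inE /A/= in_itv/= => /andP[].
rewrite (@iint_prod _ u (fun j => if j == i then 1 - s else 1)).
- rewrite (bigD1 i)//= eqxx big1 ?mulr1// => j ji; by rewrite (negbTE ji).
- by move=> j; rewrite /u; case: eqP => // _; exact: measurable_indic.
- by move=> j x; rewrite /u; case: eqP.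
- move=> j; rewrite /u; case: eqP => _.
    rewrite integral_indic// setIidl; last first.
      by move=> x /=; rewrite !in_itv/= => /andP[sx ->]; rewrite (le_trans s0 sx).
    rewrite /= lebesgue_measure_itv/= lte_fin; case: ltP => // s1'.
    by rewrite (@le_anti _ _ s 1) ?s1// subrr.
  by rewrite integral_cst//= lebesgue_measure_itv/= lte_fin ltr01 -EFinB subr0 mule1.
Qed.

End product_integral.

(* Two inputs with the same information get the same output [c]. *)
Lemma half_dist (R : realType) (a b c : R) (e : \bar R) :
  ((`|a - c|)%:E <= e -> (`|b - c|)%:E <= e -> (`|a - b| / 2)%:E <= e)%E.
Proof.
case: e => [r| |]; rewrite ?leey ?leeNy_eq//= !lee_fin => ac bc.
rewrite ler_pdivrMr// mulr_natr mulr2n (le_trans _ (lerD ac bc))//.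
by rewrite -[`|b - c|]normrN opprB (le_trans _ (ler_normD _ _))// addrA subrK.
Qed.

Section tests.
Variables (R : realType) (d : nat).
Implicit Types (P : set (d.-tuple R) -> \bar R) (Q : probability (d.-tuple R) R).

Lemma D_TV_ge P Q A (p : R) : measurable A -> P A = p%:E ->
  ((`|p - fine (Q A)|)%:E <= D_TV P Q)%E.
Proof.
move=> mA PA; rewrite -abse_EFin EFinB fineK ?fin_num_measure// -PA.
by apply: ereal_sup_ubound; exists A.
Qed.

(** If |ln h| <= r almost everywhere, integrating exp(-r) <= h <= exp(r) over A compares the two
    masses of A within the same factors; since P A is positive, so is Q A, and logarithms may be
    taken. *)
Lemma D_suplog_ge P Q A (p : R) : measurable A -> P A = p%:E -> 0 < p ->
  ((`|ln p - ln (fine (Q A))|)%:E <= D_suplog P Q)%E.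
Proof.
move=> mA PA p0; apply: le_ereal_inf_tmp => _ [h [mh h0 Ph ->]].
have mhA : measurable_fun A (fun x => (h x)%:E).
  by apply/measurable_EFinP; exact: measurable_funTS.
have key (r : R) : (\forall x \ae Q, (`|ln (h x)|)%:E <= r%:E)%E ->
    `|ln p - ln (fine (Q A))| <= r.
  move=> hr.
  have Pr : (P A <= (expR r)%:E * Q A)%E.
    rewrite (Ph A mA) -(integral_cst Q mA).
    apply: ae_ge0_le_integral => //.
    - by move=> x _; rewrite lee_fin ltW.
    - by move=> x _; rewrite lee_fin expR_ge0.
    - near=> x => _; rewrite lee_fin -[h x]lnK ?posrE// ler_expR.
      rewrite (le_trans (ler_norm _))// -lee_fin.
      by near: x; exact: hr.
  have Pl : ((expR (- r))%:E * Q A <= P A)%E.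
    rewrite (Ph A mA) -(integral_cst Q mA).
    apply: ae_ge0_le_integral => //.
    - by move=> x _; rewrite lee_fin expR_ge0.
    - by move=> x _; rewrite lee_fin ltW.
    - near=> x => _; rewrite lee_fin -[h x]lnK ?posrE// ler_expR lerNl.
      rewrite (le_trans (ler_norm _))// normrN -lee_fin.
      by near: x; exact: hr.
  have [q qE] : exists q, Q A = q%:E.
    by exists (fine (Q A)); rewrite fineK// fin_num_measure.
  move: Pr Pl; rewrite PA qE -!EFinM !lee_fin /= => Pr Pl.
  have q0 : 0 < q by rewrite -(pmulr_rgt0 _ (expR_gt0 r)) (lt_le_trans p0).
  rewrite ler_norml; apply/andP; split.
    rewrite lerBrDl -[- r]expRK addrC -lnM ?posrE ?expR_gt0// ler_ln ?posrE//.
    by rewrite mulr_gt0// expR_gt0.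
  rewrite lerBlDl -[r in leRHS]expRK addrC -lnM ?posrE ?expR_gt0// ler_ln ?posrE//.
  by rewrite mulr_gt0// expR_gt0.
case: (ess_sup Q _) (ess_sup_ge Q (fun x => (`|ln (h x)|)%:E)) => [r| |] hr.
- by rewrite lee_fin; exact: key.
- exact: leey.
(* An essential supremum equal to -oo is excluded: it would bound an absolute value by -1. *)
- have : `|ln p - ln (fine (Q A))| <= -1.
    by apply: key; apply: filterS hr => x /=; rewrite leeNy_eq.
  by rewrite leNgt (lt_le_trans _ (normr_ge0 _))// ltrN10.
Unshelve. all: end_near. Qed.

(** The easy half of Kantorovich-Rubinstein duality: integrate the Lipschitz inequality, in both
    directions, against an arbitrary coupling. [P'] turns the set function [P] into a measure, under
    which phi can be integrated. *)
Lemma W1_ge P Q (P' : probability (d.-tuple R) R) (phi : d.-tuple R -> R) :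
  (forall A, measurable A -> P A = P' A) ->
  measurable_fun setT phi -> (forall x, 0 <= phi x <= 1) ->
  (forall x y, phi x <= phi y + eucl x y) ->
  ((`|fine (\int[P']_x (phi x)%:E) - fine (\int[Q]_x (phi x)%:E)|)%:E <= W1 P Q)%E.
Proof.
move=> PE mphi phi01 lip; apply: le_ereal_inf_tmp => _ [pi [pi1 pi2 ->]].
have mE : measurable_fun setT (fun x => (phi x)%:E) by exact/measurable_EFinP.
have p0 x : (0 <= (phi x)%:E)%E by rewrite lee_fin; have /andP[] := phi01 x.
have fin (T : probability (d.-tuple R) R) :
    (\int[T]_x (phi x)%:E = (fine (\int[T]_x (phi x)%:E))%:E)%E.
  rewrite fineK// ge0_fin_numE ?integral_ge0//.
  apply: (@le_lt_trans _ _ (\int[T]_x 1%:E)%E); last first.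
    by rewrite integral_cst//= probability_setT mule1 ltry.
  apply: ge0_le_integral => // x _; rewrite lee_fin.
  by have /andP[] := phi01 x.
have i1 : (\int[P']_x (phi x)%:E = \int[pi]_z (phi z.1)%:E)%E.
  have := @ge0_integral_pushforward _ _ _ _ _ _ (@measurable_fst _ _ (d.-tuple R) (d.-tuple R))
     pi setT _ measurableT mE.
  rewrite preimage_setT => <-; last by move=> y _; exact: p0.
  apply: eq_measure_integral => A mA _; transitivity (P A).
    exact: esym (PE A mA).
  rewrite -pi1//; transitivity (pi (fst @^-1` A)); last by [].
  by congr (pi _); apply/seteqP; split => -[x y] /=; [case|].
have i2 : (\int[Q]_x (phi x)%:E = \int[pi]_z (phi z.2)%:E)%E.
  have := @ge0_integral_pushforward _ _ _ _ _ _ (@measurable_snd _ _ (d.-tuple R) (d.-tuple R))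
     pi setT _ measurableT mE.
  rewrite preimage_setT => <-; last by move=> y _; exact: p0.
  apply: eq_measure_integral => A mA _; transitivity (pi (setT `*` A)).
    exact: esym (pi2 A mA).
  transitivity (pi (snd @^-1` A)); last by [].
  by congr (pi _); apply/seteqP; split => -[x y] /=; [case|].
have m1 : measurable_fun setT (fun z : d.-tuple R * d.-tuple R => (phi z.1)%:E).
  exact: (measurableT_comp mE measurable_fst).
have m2 : measurable_fun setT (fun z : d.-tuple R * d.-tuple R => (phi z.2)%:E).
  exact: (measurableT_comp mE measurable_snd).
have mc : measurable_fun setT (fun z : d.-tuple R * d.-tuple R => (eucl z.1 z.2)%:E).
  by apply/measurable_EFinP; exact: measurable_eucl.
have c0 (z : d.-tuple R * d.-tuple R) : (0 <= (eucl z.1 z.2)%:E)%E.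
  by rewrite lee_fin eucl_ge0.
have lip' x y : phi y <= phi x + eucl x y.
  have -> : eucl x y = eucl y x.
    by congr Num.sqrt; apply: eq_bigr => i _; rewrite -sqrrN opprB.
  exact: lip.
have le12 : (\int[pi]_z (phi z.1)%:E <=
    \int[pi]_z (phi z.2)%:E + \int[pi]_z (eucl z.1 z.2)%:E)%E.
  rewrite -ge0_integralD//; apply: ge0_le_integral => //.
  - exact: emeasurable_funD.
  - by move=> z _; rewrite -EFinD lee_fin.
have le21 : (\int[pi]_z (phi z.2)%:E <=
    \int[pi]_z (phi z.1)%:E + \int[pi]_z (eucl z.1 z.2)%:E)%E.
  rewrite -ge0_integralD//; apply: ge0_le_integral => //.
  - exact: emeasurable_funD.
  - by move=> z _; rewrite -EFinD lee_fin.
move: le12 le21; rewrite -i1 -i2 (fin P') (fin Q).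
case: (\int[pi]_z (eucl z.1 z.2)%:E)%E => [c| |].
- by rewrite -!EFinD !lee_fin ler_norml => ? ?; apply/andP; split; lra.
- by rewrite !leey.
- by rewrite addeNy leeNy_eq.
Qed.

End tests.

Section lower.
Variables (R : realType) (d : nat) (i0 : 'I_d) (B t : R) (f : d.-tuple R -> R).
Hypotheses (B0 : 0 <= B) (t0 : 0 <= t) (fB : bounded_cont B f).
Hypothesis f0 : forall x, 1 / 2 <= tnth x i0 -> f x = 0.
Hypothesis ft : expR t <= Zf f.
Local Notation lam := (cube_prob R d).
Local Notation Qb := (@cube R d).
Local Notation z := (fun _ : d.-tuple R => 0 : R).

Let zB : bounded_cont B z.
Proof.
split => [x xc e e0|x xc]; last by rewrite normr0.
by exists 1 => // y _ _; rewrite subrr normr0.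
Qed.

Let Zz : Zf z = 1.
Proof.
apply/EFin_inj; rewrite -(Zf_integral B0 zB).
rewrite (eq_integral (cst 1%:E)); last first.
  by move=> x _; rewrite patchE; case: ifP => _; rewrite expR0.
by rewrite integral_cst//= probability_setT mule1.
Qed.

Let Z1 : 1 <= Zf f.
Proof. by rewrite (le_trans _ ft)// -expR0 ler_expR. Qed.

Let Z0 : 0 < Zf f. Proof. exact: lt_le_trans Z1. Qed.

Let pdf_f x : 1 / 2 <= tnth x i0 -> gibbs_pdf f x = (Zf f)^-1.
Proof.
move=> xh; rewrite /gibbs_pdf patchE.
by case: ifP => _; rewrite ?f0// expR0 div1r.
Qed.

Let pdf_z x : gibbs_pdf z x = 1.
Proof. by rewrite /gibbs_pdf Zz patchE; case: ifP => _; rewrite expR0 divr1. Qed.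

Let Zinv : (Zf f)^-1 <= expR (- t).
Proof. by rewrite expRN lef_pV2 ?posrE ?expR_gt0. Qed.

(** A slab of volume 1/4 on which f vanishes. Starting at 3/4 rather than 1/2 keeps it at distance
    1/4 from the points where f may be nonzero, which the Lipschitz test function for W_1 needs. *)
Let A := [set x : d.-tuple R | 3 / 4 <= tnth x i0].

Let mA : measurable A.
Proof.
exact: measurable_half_space.
Qed.

Let lamA : (\int[lam]_x (\1_A x)%:E = (1 / 4)%:E)%E.
Proof.
rewrite integral_indic// setIT; transitivity ((1 - 3 / 4)%:E : \bar R).
  by apply: cube_prob_half_space; lra.
by congr EFin; lra.
Qed.

Let PzA : Pf z A = (1 / 4)%:E.
Proof.
rewrite (PfE B0 zB mA) -lamA; apply: eq_integral => x _.
by rewrite pdf_z mule1.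
Qed.

Let PfA : Pf f A = (1 / 4 * (Zf f)^-1)%:E.
Proof.
rewrite (PfE B0 fB mA) EFinM -lamA -ge0_integralZr//.
- apply: eq_integral => x _; rewrite indicE; case: (boolP (x \in A)) => [|_]; last first.
    by rewrite !mul0e.
  by rewrite inE /A /= => xA; rewrite pdf_f//; lra.
- by apply/measurable_EFinP; exact: measurable_indic.
- by rewrite lee_fin invr_ge0 ltW.
Qed.

Lemma D_abs_lower (y : R) (e : \bar R) :
  (D_abs (Lf f) y <= e -> D_abs (Lf z) y <= e -> (t / 2)%:E <= e)%E.
Proof.
move=> fe ze; apply: le_trans (half_dist fe ze).
rewrite lee_fin ler_pM2r// /Lf Zz ln1 subr0 (le_trans _ (ler_norm _))//.
by rewrite -[leLHS]expRK ler_ln ?posrE ?expR_gt0.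
Qed.

(** The masses of A are 1/4 and 1/4 divided by Z_f, so their logarithms differ by exactly log Z_f,
    which is at least t. *)
Lemma D_suplog_lower Q (e : \bar R) :
  (D_suplog (Pf f) Q <= e -> D_suplog (Pf z) Q <= e -> (t / 2)%:E <= e)%E.
Proof.
move=> fe ze.
have Zi0 : 0 < 1 / 4 * (Zf f)^-1 by rewrite mulr_gt0 ?invr_gt0//; lra.
have h0 : 0 < 1 / 4 :> R by lra.
apply: le_trans (half_dist (le_trans (D_suplog_ge Q mA PfA Zi0) fe)
                           (le_trans (D_suplog_ge Q mA PzA h0) ze)).
rewrite lee_fin ler_pM2r// distrC -ln_div ?posrE// (le_trans _ (ler_norm _))//.
have -> : 1 / 4 / (1 / 4 * (Zf f)^-1) = Zf f by field; rewrite gt_eqF.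
by rewrite -[leLHS]expRK ler_ln ?posrE ?expR_gt0.
Qed.

(** The masses of A differ by (1 - 1/Z_f) / 4, and the worse of the two errors is at least half of
    this. *)
Lemma D_TV_lower Q (e : \bar R) :
  (D_TV (Pf f) Q <= e -> D_TV (Pf z) Q <= e -> ((1 - expR (- t)) / 8)%:E <= e)%E.
Proof.
move=> fe ze.
apply: le_trans (half_dist (le_trans (D_TV_ge Q mA PfA) fe)
                           (le_trans (D_TV_ge Q mA PzA) ze)).
rewrite lee_fin distrC; have := ler_norm (1 / 4 - 1 / 4 * (Zf f)^-1); have := Zinv.
lra.
Qed.

Lemma W1_lower Q (e : \bar R) :
  (W1 (Pf f) Q <= e -> W1 (Pf z) Q <= e -> ((1 - expR (- t)) / 32)%:E <= e)%E.
Proof.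
move=> fe ze.
(* The distance to the half-space where the coordinate [i0] is at most 1/2, capped at 1. It vanishes
   wherever f may not, so its integral under P_f is its Lebesgue integral divided by Z_f. Being at
   least 1/4 on [A], it has Lebesgue integral at least 1/16; halving gives 1/32. *)
pose phi (x : d.-tuple R) := Num.min 1 (Num.max 0 (tnth x i0 - 1 / 2)).
have mphi : measurable_fun setT phi.
  apply: measurable_minr => //; apply: measurable_maxr => //.
  by apply: measurable_funB => //; exact: measurable_tnth.
have phi01 x : 0 <= phi x <= 1.
  by rewrite /phi le_min ge_min le_max !lexx ler01.
have lip x y : phi x <= phi y + eucl x y.
  have : `|tnth x i0 - tnth y i0| <= eucl x y.
    rewrite -sqrtr_sqr; apply: ler_wsqrtr; rewrite (bigD1 i0)//= lerDl.
    by apply: sumr_ge0 => i _; exact: sqr_ge0.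
  move: (eucl x y) (eucl_ge0 x y) => c c0; rewrite /phi.
  move: (tnth x i0) (tnth y i0) => a b /(le_trans (ler_norm _)) abc.
  rewrite !maxEle; repeat (case: ifPn; rewrite -?ltNge => ?);
    by rewrite !minEle; repeat (case: ifPn; rewrite -?ltNge => ?); lra.
have mE : measurable_fun setT (fun x => (phi x)%:E) by exact/measurable_EFinP.
have p0 x : (0 <= (phi x)%:E)%E by rewrite lee_fin; have /andP[] := phi01 x.
have [P [_ PE IP]] := gibbs_probability B0 fB.
have [P0 [_ P0E IP0]] := gibbs_probability B0 zB.
have IP0' : (\int[P0]_x (phi x)%:E = \int[lam]_x (phi x)%:E)%E.
  by rewrite IP0//; apply: eq_integral => x _; rewrite pdf_z mule1.
have IP' : (\int[P]_x (phi x)%:E = \int[lam]_x (phi x)%:E * ((Zf f)^-1)%:E)%E.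
  rewrite IP// -ge0_integralZr//; last by rewrite lee_fin invr_ge0 ltW.
  apply: eq_integral => x _; have [xh|xh] := leP (1 / 2) (tnth x i0).
    by rewrite pdf_f.
  have -> : phi x = 0.
    rewrite /phi max_l; first by rewrite min_r.
    by rewrite subr_le0 ltW.
  by rewrite !mul0e.
have fin : (\int[lam]_x (phi x)%:E = (fine (\int[lam]_x (phi x)%:E))%:E)%E.
  rewrite fineK// ge0_fin_numE ?integral_ge0//.
  apply: (@le_lt_trans _ _ (\int[lam]_x 1%:E)%E); last first.
    by rewrite integral_cst//= probability_setT mule1 ltry.
  apply: ge0_le_integral => // x _; rewrite lee_fin.
  by have /andP[] := phi01 x.
have a16 : 1 / 16 <= fine (\int[lam]_x (phi x)%:E)%E.
  rewrite -lee_fin -fin (_ : 1 / 16 = 1 / 4 * (1 / 4) :> R); last by lra.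
  rewrite EFinM -{1}lamA -ge0_integralZr//; last first.
    by apply/measurable_EFinP; exact: measurable_indic.
  apply: ge0_le_integral => //.
  - by apply/measurable_EFinP; apply: measurable_funM => //; exact: measurable_indic.
  - move=> x _; rewrite -EFinM lee_fin indicE.
    case: (boolP (x \in A)) => [|_]; last by rewrite mul0r; have /andP[] := phi01 x.
    rewrite inE /A /= => xA; rewrite mul1r /phi le_min le_max.
    by apply/andP; split; [lra|apply/orP; right; lra].
have := half_dist (le_trans (W1_ge Q PE mphi phi01 lip) fe)
                  (le_trans (W1_ge Q P0E mphi phi01 lip) ze).
apply: le_trans; rewrite IP' IP0' fin /=.
move: (fine _) a16 => a a16.
rewrite lee_fin distrC; have := ler_norm (a - a * (Zf f)^-1).
have := Zinv; have : (Zf f)^-1 <= 1 by rewrite invf_le1.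
move: ((Zf f)^-1) (expR _) => u v u1 uv; nra.
Qed.

End lower.

(** * Fooling functions *)

Section bump.
Variable R : realType.

Definition pos (x : R) : R := Num.max 0 x.

Lemma pos_ge0 x : 0 <= pos x. Proof. by rewrite /pos le_max lexx. Qed.

Lemma pos_idP x : 0 <= x -> pos x = x. Proof. exact: max_r. Qed.

Lemma pos_eq0 x : x <= 0 -> pos x = 0. Proof. exact: max_l. Qed.

Lemma mul_pos x : x * pos x = pos x ^+ 2.
Proof.
have [x0|/ltW x0] := leP 0 x; first by rewrite pos_idP.
by rewrite pos_eq0// mulr0 expr0n.
Qed.

Lemma pos_exp_mul k x : pos x ^+ k.+1 * x = pos x ^+ k.+2.
Proof. by rewrite exprSr -mulrA [pos x * x]mulrC mul_pos -exprD addn2. Qed.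

Lemma continuous_pos : continuous pos.
Proof.
move=> x; apply/cvgrPdist_lt => e e0; near=> y.
apply: (@le_lt_trans _ _ `|x - y|); last first.
  by near: y; apply/nbhs_ballP; exists e.
rewrite /pos !maxEle; case: ifPn; rewrite -?ltNge => h1;
  case: ifPn; rewrite -?ltNge => h2; rewrite ?subr0 ?sub0r ?normrN ?subrr ?normr0//.
  by rewrite ger0_norm// (le_trans _ (ler_norm _))//; lra.
by rewrite ger0_norm// distrC (le_trans _ (ler_norm _))//; lra.
Unshelve. all: end_near. Qed.

(** A quadratic remainder forces the derivative; this covers [pos x ^+ 2] at its kink as well as
    elsewhere. *)
Lemma is_derive_quadratic (F : R -> R) (x c : R) :
  (forall y, `|F y - F x - c * (y - x)| <= (y - x) ^+ 2) -> is_derive x 1 F c.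
Proof.
move=> Fx.
have cv : h^-1 *: ((F \o shift x) (h *: (1 : R)) - F x) @[h --> 0^'] --> c.
  apply/cvgrPdist_le => e e0; near=> h.
  have h0 : h != 0 by near: h; exact: nbhs_dnbhs_neq.
  have he : `|h| <= e.
    near: h; apply: dnbhs0_le => //.
  have := Fx (h + x); rewrite addrK /= => H.
  rewrite [h *: 1]mulr1 distrC; apply: le_trans he.
  have -> : h^-1 *: (F (h + x) - F x) - c = h^-1 * (F (h + x) - F x - c * h).
    by rewrite mulrBr [c * h]mulrC mulKf.
  rewrite normrM normfV ler_pdivrMl ?normr_gt0//.
  by rewrite (le_trans H)// -real_normK ?num_real// expr2.
apply: DeriveDef; first by apply/cvg_ex; exists c.
exact/cvg_lim.
Unshelve. all: end_near. Qed.

Lemma is_derive_mul (f g : R -> R) (x df dg : R) :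
  is_derive x 1 f df -> is_derive x 1 g dg ->
  is_derive x 1 (fun t => f t * g t) (df * g x + f x * dg).
Proof.
move=> Hf Hg; apply: (is_derive_eq (is_deriveM Hf Hg)).
by change (f x * dg + g x * df = df * g x + f x * dg); ring.
Qed.

Lemma is_derive_pos_exp k (x : R) :
  is_derive x 1 (fun x => pos x ^+ k.+2) (k.+2%:R * pos x ^+ k.+1).
Proof.
elim: k => [|k IH].
  apply: is_derive_quadratic => y; rewrite expr1.
  have [x0|/ltW x0] := leP 0 x; have [y0|/ltW y0] := leP 0 y;
    rewrite ?(pos_idP x0) ?(pos_idP y0) ?(pos_eq0 x0) ?(pos_eq0 y0) ?expr0n/=.
  - by rewrite (_ : _ - _ = (y - x) ^+ 2) ?ger0_norm ?sqr_ge0//; ring.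
  - by rewrite ler_norml; nra.
  - by rewrite ler_norml; nra.
  - by rewrite !(mulr0, mul0r, subr0) normr0 sqr_ge0.
have -> : (fun x => pos x ^+ k.+3) = (fun x => pos x ^+ k.+2 * x).
  by apply/funext => y; rewrite pos_exp_mul.
apply: (is_derive_eq (is_derive_mul IH (is_derive_id x 1))).
rewrite mulr1 -mulrA pos_exp_mul [k.+3%:R]mulrS; ring.
Qed.

Definition parab (t : R) : R := t * (1 - t).

Lemma is_derive_parab (t : R) : is_derive t 1 parab (1 - 2 * t).
Proof.
have H := is_derive_mul (is_derive_id t 1)
  (is_deriveB (is_derive_cst (1 : R) t 1) (is_derive_id t 1)).
by apply: (is_derive_eq H); change (1 * (1 - t) + t * (0 - 1) = 1 - 2 * t); ring.
Qed.

Lemma parab_le0 t : ~~ (0 < t < 1) -> parab t <= 0.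
Proof. by rewrite /parab; case: (ltP 0 t) => t0; case: (ltP t 1) => t1 //= _; nra. Qed.

(** The cofactor q_r in the r-th derivative pos(p)^(m+1-r) q_r, where p = X - X^2. The recursion is
    the product rule, combined with pos(p)^(k+2) = pos(p)^(k+1) p. The exponent m + 1 leaves one
    factor pos(p) at order m, so that this derivative is still continuous and zero at the ends. *)
Fixpoint cell_bump_poly (m r : nat) : {poly R} :=
  if r is r'.+1 then
    (m.+1 - r')%:R *: (1 - 2%:R *: 'X) * cell_bump_poly m r' + ('X - 'X ^+ 2) * (cell_bump_poly m r')^`()
  else 1.

(* For [r <= m], the [r]-th derivative of [pos (parab t) ^+ m.+1]. *)
Definition cell_bump (m r : nat) (t : R) : R := pos (parab t) ^+ (m.+1 - r) * (cell_bump_poly m r).[t].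

Lemma is_derive_cell_bump m r (t : R) : (r < m)%N -> is_derive t 1 (cell_bump m r) (cell_bump m r.+1 t).
Proof.
move=> rm.
have [k E1 E2] : exists2 k, (m.+1 - r = k.+2)%N & (m.+1 - r.+1 = k.+1)%N.
  by exists (m.-1 - r)%N; lia.
have d1 := is_derive1_comp (is_derive_pos_exp k (parab t)) (is_derive_parab t).
have d2 := is_derive_poly (cell_bump_poly m r) t.
have := is_derive_mul d1 d2; rewrite /cell_bump E1 E2.
move=> H; apply: (is_derive_eq H).
rewrite /= E1 !hornerE -[pos (parab t) ^+ k.+2]pos_exp_mul /parab.
ring.
Qed.

Lemma continuous_cell_bump m r : continuous (cell_bump m r).
Proof.
have -> : cell_bump m r = (fun t => pos (parab t) ^+ (m.+1 - r)) \* horner (cell_bump_poly m r) by [].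
move=> t; apply: continuousM; last exact: continuous_horner.
apply: (@continuous_comp _ _ _ (pos \o parab) (fun x : R => x ^+ (m.+1 - r))); last first.
  exact: exprn_continuous.
apply: continuous_comp; last exact: continuous_pos.
have [d1 _] := is_derive_parab t.
exact/differentiable_continuous/derivable1_diffP.
Qed.

Lemma cell_bump_eq0 m r t : (r <= m)%N -> ~~ (0 < t < 1) -> cell_bump m r t = 0.
Proof.
by move=> rm t01; rewrite /cell_bump pos_eq0 ?parab_le0// subSn// expr0n mul0r.
Qed.

Lemma cell_bump_bounded m : exists2 K : R, 1 <= K & forall r t, (r <= m)%N -> `|cell_bump m r t| <= K.
Proof.
have bd r : exists K : R, forall t, 0 < t < 1 -> `|cell_bump m r t| <= K.
  have [||c _ cmax] := @EVT_max R (fun t => `|cell_bump m r t|) 0 1; rewrite ?ler01//.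
    apply: continuous_subspaceT => t.
    apply: (@continuous_comp _ _ _ (cell_bump m r) (fun x : R => `|x|)); first exact: continuous_cell_bump.
    exact: norm_continuous.
  exists `|cell_bump m r c| => t /andP[t0 t1]; apply: cmax.
  by rewrite in_itv/= !ltW.
have [K KP] := choice bd.
(* The sum dominates the maxima of all orders at once; the 1 makes the bound positive, as it later
   appears in a denominator. *)
exists (1 + \sum_(r < m.+1) `|K r|); first by rewrite lerDl sumr_ge0.
move=> r t rm.
have S0 : 0 <= \sum_(r < m.+1) `|K r| by exact: sumr_ge0.
have [t01|t01] := boolP (0 < t < 1); last first.
  by rewrite cell_bump_eq0// normr0 addr_ge0.
rewrite (le_trans (KP r t t01))// (le_trans (ler_norm _))//.
rewrite (bigD1 (Ordinal (rm : (r < m.+1)%N)))//= addrCA lerDl addr_ge0//.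
exact: sumr_ge0.
Qed.

Lemma cell_bump_ge0 m t : 0 <= cell_bump m 0 t.
Proof. by rewrite /cell_bump hornerC mulr1 exprn_ge0// pos_ge0. Qed.

(** On the middle half of the unit interval [parab] is at least 3/16. *)
Lemma cell_bump_lower m t : 1 / 4 <= t <= 3 / 4 -> (1 / 8) ^+ m.+1 <= cell_bump m 0 t.
Proof.
move=> /andP[t1 t2]; rewrite /cell_bump hornerC mulr1 subn0.
have h : 1 / 8 <= parab t by rewrite /parab; nra.
rewrite pos_idP; last by rewrite (le_trans _ h)//; lra.
by rewrite lerXn2r ?nnegrE//; lra.
Qed.

End bump.

Section continuity.
Variable R : realType.

Lemma continuous_bigsum (T : topologicalType) (I : Type) (s : seq I) (F : I -> T -> R) :
  (forall i, continuous (F i)) -> continuous (fun x => \sum_(i <- s) F i x).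
Proof.
move=> cF; elim: s => [|i s IH].
  rewrite [X in continuous X](_ : _ = cst 0); first by move=> x; exact: cvg_cst.
  by apply/funext => x; rewrite big_nil.
rewrite [X in continuous X](_ : _ = (fun x => F i x + \sum_(j <- s) F j x)).
  by move=> x; apply: continuousD; [exact: cF|exact: IH].
by apply/funext => x; rewrite big_cons.
Qed.

Lemma continuous_bigprod (T : topologicalType) (I : Type) (s : seq I) (F : I -> T -> R) :
  (forall i, continuous (F i)) -> continuous (fun x => \prod_(i <- s) F i x).
Proof.
move=> cF; elim: s => [|i s IH].
  rewrite [X in continuous X](_ : _ = cst 1); first by move=> x; exact: cvg_cst.
  by apply/funext => x; rewrite big_nil.
rewrite [X in continuous X](_ : _ = (fun x => F i x * \prod_(j <- s) F j x)).
  by move=> x; apply: continuousM; [exact: cF|exact: IH].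
by apply/funext => x; rewrite big_cons.
Qed.

(** Row vectors carry the topology in which sums and products are known to be continuous, and their
    balls are coordinatewise, as in [cont_on_cube]. *)
Lemma cont_on_cube_row d (F : 'rV[R]_d -> R) : continuous F ->
  cont_on_cube (fun x : d.-tuple R => F (\row_i tnth x i)).
Proof.
move=> cF x _ e e0.
have /cvgrPdist_lt /(_ e e0) /nbhs_ballP[dl /= dl0 H] := cF (\row_i tnth x i).
exists dl => // y _ yx; rewrite distrC; apply: H; split => // i j.
by rewrite !mxE /ball /= distrC; exact: yx.
Qed.

Lemma is_derive_bigsum (I : Type) (s : seq I) (h : I -> R -> R) (dh : I -> R) (x : R) :
  (forall i, is_derive x 1 (h i) (dh i)) ->
  is_derive x 1 (fun t => \sum_(i <- s) h i t) (\sum_(i <- s) dh i).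
Proof.
move=> H; elim: s => [|i s IH].
  rewrite big_nil [X in is_derive _ _ X _](_ : _ = cst 0); first exact: is_derive_cst.
  by apply/funext => t; rewrite big_nil.
rewrite big_cons [X in is_derive _ _ X _](_ : _ = h i + (fun t => \sum_(j <- s) h j t)).
  exact: is_deriveD.
by apply/funext => t; rewrite big_cons.
Qed.

End continuity.

Section fooling.
Variables (R : realType) (m d M : nat) (w : {ffun 'I_d -> 'I_M} -> bool) (eta : R).
Hypotheses (M0 : (0 < M)%N) (eta0 : 0 <= eta).
Local Notation a := ((2 * M)%:R : R).
Local Notation Qb := (@cube R d).

(** The parameter s gives the partial derivatives in closed form: [fool [::]] is the function and,
    for size s <= m, [fool s] is its derivative along s, with a factor a per derivative from the
    chain rule. As a = 2 M, the cells have side 1/(2M) and fill [0,1/2]^d; [w] selects those that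
    carry a bump. *)
Definition fool (s : seq 'I_d) (x : d.-tuple R) : R :=
  \sum_(c : {ffun 'I_d -> 'I_M}) (w c)%:R * (eta * a ^+ size s) *
    \prod_(i < d) cell_bump m (count_mem i s) (a * tnth x i - (c i)%:R).

Let a0 : 0 < a. Proof. by rewrite ltr0n muln_gt0. Qed.

Lemma is_derive_fool (i : 'I_d) (s : seq 'I_d) (x : d.-tuple R) : (size s < m)%N ->
  is_derive (tnth x i) 1 (fun t => fool s (upd x i t)) (fool (i :: s) x).
Proof.
move=> sm; apply: is_derive_bigsum => c.
set A := (w c)%:R * _; set P := \prod_(j < d | j != i)
  cell_bump m (count_mem j s) (a * tnth x j - (c j)%:R).
pose g (t : R) := cell_bump m (count_mem i s) (a * t - (c i)%:R).
have -> : (fun t => A * \prod_(j < d)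
     cell_bump m (count_mem j s) (a * tnth (upd x i t) j - (c j)%:R)) = (fun t => (A * P) * g t).
  apply/funext => t; rewrite (bigD1 i)//= tnth_upd eqxx -/(g t) -mulrA [P * _]mulrC.
  congr (_ * (_ * _)); apply: eq_bigr => j ji.
  by rewrite tnth_upd (negbTE ji).
have dg : is_derive (tnth x i) 1 g
    (cell_bump m (count_mem i s).+1 (a * tnth x i - (c i)%:R) * a).
  apply: (@is_derive1_comp _ (cell_bump m (count_mem i s)) (fun t => a * t - (c i)%:R)).
    by apply: is_derive_cell_bump; rewrite (leq_ltn_trans _ sm)// count_size.
  have H := is_deriveB (is_derive_mul (is_derive_cst a (tnth x i) 1) (is_derive_id (tnth x i) 1))
     (is_derive_cst ((c i)%:R : R) (tnth x i) 1).
  by apply: (is_derive_eq H); change (0 * tnth x i + a * 1 - 0 = a); ring.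
have H := is_derive_mul (is_derive_cst (A * P) (tnth x i) 1) dg.
apply: (is_derive_eq H); rewrite mul0r add0r [RHS](_ : _ =
  (w c)%:R * (eta * a ^+ size (i :: s)) *
   (cell_bump m (count_mem i s).+1 (a * tnth x i - (c i)%:R) * P)); last first.
  congr (_ * _); rewrite (bigD1 i)//= eqxx add1n; congr (_ * _).
  by apply: eq_bigr => j ji; rewrite eq_sym (negbTE ji) add0n.
by rewrite /A /= exprS; ring.
Qed.

Lemma dpart_fool s x : (size s <= m)%N -> dpart s (fool [::]) x = fool s x.
Proof.
elim: s x => [//|i s IH] x sm /=; rewrite /partial.
have -> : dpart s (fool [::]) = fool s by apply/funext => y; rewrite IH// ltnW.
by rewrite derive1E; have [_ ->] := is_derive_fool i x sm.
Qed.

Lemma cont_fool s : cont_on_cube (fool s).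
Proof.
have := @cont_on_cube_row R d (fun v => \sum_(c : {ffun 'I_d -> 'I_M})
  (w c)%:R * (eta * a ^+ size s) *
    \prod_(i < d) cell_bump m (count_mem i s) (a * v 0 i - (c i)%:R)).
have E : (fun x : d.-tuple R => \sum_(c : {ffun 'I_d -> 'I_M})
  (w c)%:R * (eta * a ^+ size s) * \prod_(i < d)
    cell_bump m (count_mem i s) (a * (\row_i tnth x i) 0 i - (c i)%:R)) = fool s.
  apply/funext => x; apply: eq_bigr => c _; congr (_ * _).
  by apply: eq_bigr => i _; rewrite mxE.
rewrite E; apply; apply: continuous_bigsum => c.
move=> v; apply: (@continuousM _ _ (cst ((w c)%:R * (eta * a ^+ size s)))).
  exact: cst_continuous.
apply: continuous_bigprod => i {}v.
apply: (@continuous_comp _ _ _ (fun v : 'rV[R]_d => a * v 0 i - (c i)%:R)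
  (cell_bump m (count_mem i s))); last exact: continuous_cell_bump.
apply: (@continuousB _ _ _ (fun v : 'rV[R]_d => a * v 0 i)); last exact: cst_continuous.
apply: (@continuousM _ _ (cst a)); first exact: cst_continuous.
exact: coord_continuous.
Qed.

(* The bumps of different cells have disjoint supports. *)
Lemma cell_bump_sum_le r (K x : R) : (r <= m)%N -> 0 <= K -> (forall t, `|cell_bump m r t| <= K) ->
  \sum_(k < M) `|cell_bump m r (a * x - k%:R)| <= K.
Proof.
move=> rm K0 bK.
have [k0 k0P|H] := pickP (fun k : 'I_M => cell_bump m r (a * x - k%:R) != 0); last first.
  by rewrite big1// => k _; have /negbFE/eqP -> := H k; rewrite normr0.
rewrite (bigD1 k0)//= big1 ?addr0// => k kk0.
apply/eqP; rewrite normr_eq0; apply: contraTT kk0 => kP; rewrite negbK.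
have st j : cell_bump m r (a * x - j%:R) != 0 -> 0 < a * x - j%:R < 1.
  by move=> jP; apply: contraNT jP => j01; rewrite cell_bump_eq0.
have /andP[p1 p2] := st _ k0P; have /andP[q1 q2] := st _ kP.
apply/eqP/val_inj/eqP => /=; rewrite eqn_leq.
by apply/andP; split; rewrite -ltnS -(ltr_nat R) -[_.+1%:R]natr1; lra.
Qed.

(** The sum over cells of a product over coordinates is the product over coordinates of sums over M
    indices, and each such sum has at most one nonzero term. The number of cells therefore does not
    enter the bound. *)
Lemma fool_le (K : R) s x : 0 <= K -> (forall r t, (r <= m)%N -> `|cell_bump m r t| <= K) ->
  (size s <= m)%N -> `|fool s x| <= eta * a ^+ m * K ^+ d.
Proof.
move=> K0 bK sm.
have a1 : 1 <= a by rewrite ler1n muln_gt0.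
apply: (@le_trans _ _ (\sum_(c : {ffun 'I_d -> 'I_M}) (eta * a ^+ m) *
    \prod_(i < d) `|cell_bump m (count_mem i s) (a * tnth x i - (c i)%:R)|)).
  rewrite /fool (le_trans (ler_norm_sum _ _ _))// ler_sum// => c _.
  rewrite normrM normr_prod ler_pM// ?prodr_ge0//.
  rewrite ger0_norm ?mulr_ge0 ?exprn_ge0 ?(ltW a0)//.
  rewrite (@le_trans _ _ (1 * (eta * a ^+ size s)))//.
    by rewrite ler_wpM2r ?mulr_ge0 ?exprn_ge0 ?(ltW a0)// lern1 leq_b1.
  by rewrite mul1r ler_wpM2l// ler_weXn2l.
rewrite -big_distrr /= -(bigA_distr_bigA (fun i k =>
  `|cell_bump m (count_mem i s) (a * tnth x i - (k : 'I_M)%:R)|)) /=.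
rewrite ler_wpM2l ?mulr_ge0 ?exprn_ge0 ?(ltW a0)//.
rewrite -[in leRHS](card_ord d) -prodr_const; apply: ler_prod => i _.
have rm : (count_mem i s <= m)%N by rewrite (leq_trans _ sm)// count_size.
by rewrite sumr_ge0//= cell_bump_sum_le// => t; exact: bK.
Qed.

Lemma Fclass_fool (K B : R) : 0 <= K -> (forall r t, (r <= m)%N -> `|cell_bump m r t| <= K) ->
  eta * a ^+ m * K ^+ d <= B -> Fclass m B (fool [::]).
Proof.
move=> K0 bK etaB; split; first split.
- exact: cont_fool.
- move=> i s sm x _.
  have [H _] := is_derive_fool i x sm.
  have -> : (fun t => dpart s (fool [::]) (upd x i t)) = (fun t => fool s (upd x i t)).
    by apply/funext => t; rewrite dpart_fool// ltnW.
  exact: H.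
- move=> s /andP[_ sm]; exists (fool s); split; first exact: cont_fool.
  by move=> x _; rewrite dpart_fool.
apply: ge_ereal_sup => _ [[x _ <-]|[s /andP[_ sm] [x _ <-]]].
  by rewrite lee_fin (le_trans _ etaB)// (@fool_le K [::]).
by rewrite lee_fin dpart_fool// (le_trans _ etaB)// fool_le.
Qed.

Lemma fool_ge0 x : 0 <= fool [::] x.
Proof.
apply: sumr_ge0 => c _; rewrite !mulr_ge0 ?exprn_ge0 ?(ltW a0)//.
by apply: prodr_ge0 => i _; exact: cell_bump_ge0.
Qed.

Lemma fool_half x i : 1 / 2 <= tnth x i -> fool [::] x = 0.
Proof.
move=> xi; rewrite /fool big1// => c _.
rewrite (bigD1 i)//= cell_bump_eq0 ?mul0r ?mulr0//.
rewrite negb_and -!leNgt; apply/orP; right.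
rewrite lerBrDl natr1 (@le_trans _ _ M%:R) ?ler_nat//.
by rewrite (_ : M%:R = a * (1 / 2)) ?ler_pM2l// natrM mulrAC mulrC; field.
Qed.

(** A coordinate for which the truncation is M or more gets the default index 0. This is harmless in
    [fool_cell]: no bump is nonzero there. *)
Definition cell (x : d.-tuple R) : {ffun 'I_d -> 'I_M} :=
  [ffun i => insubd (Ordinal M0) (Num.truncn (a * tnth x i))].

Lemma fool_cell x : ~~ w (cell x) -> fool [::] x = 0.
Proof.
move=> wx; rewrite /fool big1// => c _.
have [wc|] := boolP (w c); last by rewrite !mul0r.
have [i ci] : exists i, c i != cell x i.
  apply/existsP; rewrite -negb_forall; apply: contra wx => /forallP cc.
  suff -> : cell x = c by [].
  by apply/ffunP => i; exact/esym/eqP.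
rewrite (bigD1 i)//= cell_bump_eq0 ?mul0r ?mulr0//.
apply: contra ci; rewrite subr_gt0 ltrBlDl natr1 => /andP[/ltW c1 c2].
apply/eqP/val_inj; rewrite /cell ffunE val_insubd.
have -> : Num.truncn (a * tnth x i) = c i :> nat.
  by apply: Num.Theory.truncn_def; rewrite c1 c2.
by rewrite ltn_ord.
Qed.

Let J (c : {ffun 'I_d -> 'I_M}) (i : 'I_d) : set R :=
  `[((c i)%:R + 1 / 4) / a, ((c i)%:R + 3 / 4) / a]%classic.

Let mJ c i : measurable (J c i).
Proof. exact: measurable_itv. Qed.

(** A multiple of the indicator of the concentric box with half the side: a minorant of the bump of
    the cell c whose integral is explicit. *)
Let g (c : {ffun 'I_d -> 'I_M}) (x : d.-tuple R) : R :=
  \prod_(i < d) ((1 / 8) ^+ m.+1 * \1_(J c i) (tnth x i)).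

Let g0 c x : 0 <= g c x.
Proof. by apply: prodr_ge0 => i _; rewrite mulr_ge0// exprn_ge0//; lra. Qed.

Let mg c : measurable_fun setT (g c).
Proof.
apply: measurable_prod => i _; apply: measurable_funM => //.
have mJ1 : measurable_fun setT (\1_(J c i) : R -> R) by exact: measurable_indic.
exact: (measurableT_comp mJ1 (measurable_tnth i)).
Qed.

Let gE c : (\int[cube_prob R d]_x (g c x)%:E = (((1 / 8) ^+ m.+1 / (4 * M%:R)) ^+ d)%:E)%E.
Proof.
rewrite -iintE; last 2 first.
- by apply/measurable_EFinP; exact: mg.
- by move=> x; rewrite lee_fin.
rewrite (iint_prod (u := fun i x => (1 / 8) ^+ m.+1 * \1_(J c i) x)
  (c := fun=> (1 / 8) ^+ m.+1 / (4 * M%:R))).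
- by rewrite prodr_const card_ord.
- by move=> i; apply: measurable_funM => //; exact: measurable_indic.
- by move=> i x; rewrite mulr_ge0// exprn_ge0//; lra.
move=> i; under eq_integral do rewrite EFinM.
rewrite ge0_integralZl//; last first.
  by apply/measurable_EFinP; apply: measurable_indic; exact: mJ.
rewrite EFinM; congr (_ * _)%E; rewrite integral_indic//; last exact: mJ.
rewrite setIidl; last first.
  move=> x; rewrite /J /= !in_itv/= ler_pdivrMr// ler_pdivlMr// => /andP[x1 x2].
  have cM : (c i)%:R + 1 <= M%:R :> R by rewrite natr1 ler_nat.
  have c0 : 0 <= (c i)%:R :> R by [].
  have aM : a = M%:R + M%:R by rewrite natrM mulr_natl mulr2n.
  rewrite -(ler_pM2r a0) -[x <= 1](ler_pM2r a0) mul0r mul1r.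
  by apply/andP; split; lra.
rewrite /J /= lebesgue_measure_itv/= lte_fin ltr_pM2r ?invr_gt0//.
rewrite ifT; last by lra.
rewrite -EFinB; congr EFin; rewrite natrM; field.
by rewrite pnatr_eq0 -lt0n.
Qed.

Lemma integral_fool : ((eta * #|w|%:R * ((1 / 8) ^+ m.+1 / (4 * M%:R)) ^+ d)%:E <=
  \int[cube_prob R d]_x ((fool [::] \_ Qb) x)%:E)%E.
Proof.
pose G x := \sum_(c : {ffun 'I_d -> 'I_M}) (w c)%:R * eta * g c x.
have mG : measurable_fun setT G.
  by apply: measurable_sum => c; apply: measurable_funM => //; exact: mg.
have G0 x : 0 <= G x by apply: sumr_ge0 => c _; rewrite !mulr_ge0.
have GE : (\int[cube_prob R d]_x (G x)%:E =
    (eta * #|w|%:R * ((1 / 8) ^+ m.+1 / (4 * M%:R)) ^+ d)%:E)%E.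
  under eq_integral do rewrite /G -sumEFin.
  rewrite ge0_integral_sum//; last 2 first.
  - move=> c; apply/measurable_EFinP; apply: measurable_funM => //; exact: mg.
  - by move=> c x _; rewrite lee_fin !mulr_ge0.
  transitivity (\sum_(c : {ffun 'I_d -> 'I_M})
     ((w c)%:R * (eta * ((1 / 8) ^+ m.+1 / (4 * M%:R)) ^+ d))%:E)%E.
    apply: eq_bigr => c _; under eq_integral do rewrite EFinM.
    rewrite ge0_integralZl//.
    - by rewrite gE -EFinM mulrA.
    - by apply/measurable_EFinP; exact: mg.
    - by move=> x _; rewrite lee_fin.
    - by rewrite lee_fin mulr_ge0.
  rewrite sumEFin -mulr_suml -natr_sum (_ : (\sum_c w c)%N = #|w|); first by congr EFin; ring.
  by rewrite -sum1_card [RHS]big_mkcond; apply: eq_bigr => c _; rewrite unfold_in; case: (w c).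
rewrite -GE -iintE; last 2 first.
- exact/measurable_EFinP.
- by move=> x; rewrite lee_fin.
(* [fool] is restricted to the cube, so [G] must be too before the pointwise comparison; [iint] does
   not see the change. *)
rewrite (@iint_congr _ _ _ (fun x => ((G \_ Qb) x)%:E)); last first.
  by move=> x xc; rewrite restrict_cube.
have mGQ : measurable_fun setT (G \_ Qb).
  apply/(measurable_restrictT _ (@measurable_cube R d)).
  exact: measurable_funTS.
rewrite iintE; last 2 first.
- exact/measurable_EFinP.
- by move=> x; rewrite lee_fin patchE; case: ifP.
apply: ge0_le_integral => //.
- by move=> x _; rewrite lee_fin patchE; case: ifP.
- exact/measurable_EFinP.
- by apply/measurable_EFinP; apply: measurable_restrict_cube; exact: cont_fool.
move=> x _; rewrite lee_fin !patchE; case: ifP => // _.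
apply: ler_sum => c _; rewrite expr0 mulr1 ler_wpM2l ?mulr_ge0//.
apply: ler_prod => i _; apply/andP; split; first by rewrite mulr_ge0// exprn_ge0//; lra.
rewrite indicE; case: (boolP (_ \in _)) => [|_]; last by rewrite mulr0 cell_bump_ge0.
rewrite inE /J /= in_itv/= ler_pdivrMr// ler_pdivlMr// => /andP[x1 x2].
by rewrite mulr1; apply: cell_bump_lower; lra.
Qed.

End fooling.

(** The tangent of exp at t, integrated against a probability, gives Z_f >= exp(t) (1 + int f - t),
    and int f >= t. *)
Lemma Zf_jensen (R : realType) d (B t : R) (f : d.-tuple R -> R) :
  0 <= B -> bounded_cont B f -> (forall x, 0 <= f x) -> 0 <= t ->
  (t%:E <= \int[cube_prob R d]_x ((f \_ (@cube R d)) x)%:E)%E -> expR t <= Zf f.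
Proof.
move=> B0 fB f0 t0 tf; have [cf _] := fB.
set F := f \_ _ in tf *.
have mF : measurable_fun setT F by exact: measurable_restrict_cube.
have F0 x : 0 <= F x by rewrite /F patchE; case: ifP.
have K0 := expR_ge0 t.
(* This is the tangent bound exp(F) >= exp(t) (1 + F - t) with nonnegative terms only. *)
have pw x : expR t * (1 + F x) <= expR (F x) + t * expR t.
  have := expR_ge1Dx (F x - t); rewrite expRB ler_pdivlMr ?expR_gt0//.
  by rewrite mulrDl; lra.
have mFE : measurable_fun setT (fun x => (F x)%:E) by exact/measurable_EFinP.
have mX : measurable_fun setT (fun x => expR (F x)) by exact: measurable_expR_restrict.
have one (c : R) : (\int[cube_prob R d]_x c%:E = c%:E)%E.
  by rewrite integral_cst//= probability_setT mule1.
have E1 : (\int[cube_prob R d]_x (expR t * (1 + F x))%:E =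
    (expR t)%:E * (1 + \int[cube_prob R d]_x (F x)%:E))%E.
  under eq_integral do rewrite EFinM EFinD.
  rewrite ge0_integralZl//.
  - congr (_ * _)%E; rewrite ge0_integralD//; first by congr (_ + _)%E; exact: one.
    by move=> x _; rewrite lee_fin.
  - exact: emeasurable_funD.
  - by move=> x _; rewrite -EFinD lee_fin addr_ge0.
have E2 : (\int[cube_prob R d]_x (expR (F x) + t * expR t)%:E =
    (Zf f)%:E + (t * expR t)%:E)%E.
  under eq_integral do rewrite EFinD.
  rewrite ge0_integralD//.
  - by congr (_ + _)%E; [exact: (Zf_integral B0 fB)|exact: one].
  - exact/measurable_EFinP.
  - by move=> x _; rewrite lee_fin mulr_ge0.
have H : ((expR t)%:E * (1 + t%:E) <= (Zf f)%:E + (t * expR t)%:E)%E.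
  rewrite -E2; apply: (@le_trans _ _ (\int[cube_prob R d]_x (expR t * (1 + F x))%:E)%E).
    by rewrite E1 lee_wpmul2l ?lee_fin// leeD2l.
  apply: ge0_le_integral => //.
  - by move=> x _; rewrite lee_fin mulr_ge0// addr_ge0.
  - apply/measurable_EFinP; apply: measurable_funM => //.
    exact: measurable_funD.
  - by apply/measurable_EFinP; exact: measurable_funD.
  - by move=> x _; rewrite lee_fin.
by move: H; rewrite -EFinD -EFinM -EFinD lee_fin; lra.
Qed.

(** * Rates *)

(** One N serves both bounds: N^d <= n means that a full grid can be queried, and n < (N+1)^d that n
    points miss some of (N+1)^d cells. *)
Lemma nat_root (d n : nat) : (0 < d)%N -> (0 < n)%N ->
  exists2 N, (0 < N)%N & (N ^ d <= n < N.+1 ^ d)%N.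
Proof.
move=> d0 n0.
have ex : exists N, (N ^ d <= n)%N by exists 1%N; rewrite exp1n.
have ub N : (N ^ d <= n)%N -> (N <= n)%N.
  by apply: leq_trans; case: N => // N; rewrite -[leqLHS]expn1 leq_pexp2l.
case: (ex_maxnP ex ub) => N Nn Nmax.
exists N; first by apply: Nmax; rewrite exp1n.
by rewrite Nn ltnNge; apply/negP => /Nmax; rewrite ltnn.
Qed.

(** Since N <= n^(1/d) <= N + 1 <= 2 N, passing from N^(-m) to n^(-m/d) costs a factor of at most
    2^m. *)
Lemma rate_itv (R : realType) (m d n N : nat) (B : R) : (0 < d)%N -> (0 < N)%N -> 0 < B ->
  (N ^ d <= n < N.+1 ^ d)%N ->
  rate m d B n <= B * N%:R^-1 ^+ m <= 2 ^+ m * rate m d B n.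
Proof.
move=> d0 N0 B0 /andP[Nn nN].
have dR : d%:R != 0 :> R by rewrite pnatr_eq0 -lt0n.
have E k : (k ^ d)%:R `^ (m%:R / d%:R) = k%:R ^+ m :> R.
  by rewrite natrX -powR_mulrn// -powRrM mulrCA divff// mulr1 powR_mulrn.
have mono k l : (k <= l)%N -> k%:R `^ (m%:R / d%:R) <= l%:R `^ (m%:R / d%:R) :> R.
  by move=> kl; apply: ge0_ler_powR; rewrite ?nnegrE ?ler_nat// divr_ge0.
have l1 := mono _ _ Nn; have l2 := mono _ _ (ltnW nN); rewrite !E in l1 l2.
have Nm : 0 < N%:R ^+ m :> R by rewrite exprn_gt0// ltr0n.
have p0 : 0 < n%:R `^ (m%:R / d%:R) :> R by exact: lt_le_trans l1.
rewrite /rate powRN exprVn mulrCA; apply/andP; split.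
  by rewrite ler_pM2l// lef_pV2 ?posrE.
rewrite ler_pM2l// ler_pdivlMr// ler_pdivrMl// -exprMn.
apply: le_trans l2 _; rewrite lerXn2r ?nnegrE//.
by rewrite -natrM ler_nat; lia.
Qed.

(** From exp(t) >= 1 + t one gets 1 - exp(-t) >= t / (1 + t). *)
Lemma one_sub_expRN_ge (R : realType) (t : R) : 0 <= t -> Num.min 1 t / 2 <= 1 - expR (- t).
Proof.
move=> t0; have := expR_ge1Dx t; have e0 := expR_gt0 t; rewrite expRN => H.
have E : expR t * (expR t)^-1 = 1 by rewrite divff// gt_eqF.
have v0 : 0 < (expR t)^-1 by rewrite invr_gt0.
move: ((expR t)^-1) (expR t) E v0 H e0 => v u E v0 H e0.
by rewrite minEle; case: ifPn; rewrite -?ltNge => ?; nra.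
Qed.

Lemma one_sub_expRN_le (R : realType) (t : R) : 1 - expR (- t) <= Num.min 1 t.
Proof.
rewrite le_min; have := expR_ge1Dx (- t); have := expR_ge0 (- t).
by move=> ? ?; apply/andP; split; lra.
Qed.

Lemma min1_scale (R : realType) (k r : R) : 0 <= k -> 0 <= r ->
  Num.min 1 (k * r) <= (1 + k) * Num.min 1 r.
Proof.
by move=> k0 r0; rewrite !minEle; case: ifPn; rewrite -?ltNge => ?;
  case: ifPn; rewrite -?ltNge => ?; nra.
Qed.

Lemma min1_scale_ge (R : realType) (k r : R) : 0 < k -> 0 <= r ->
  k / (1 + k) * Num.min 1 r <= Num.min 1 (k * r).
Proof.
move=> k0 r0; rewrite mulrAC ler_pdivrMr; last by rewrite addr_gt0.
by rewrite !minEle; case: ifPn; rewrite -?ltNge => ?;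
  case: ifPn; rewrite -?ltNge => ?; nra.
Qed.

(** * Recovery on the closed cube and fooling functions for n points *)

Lemma Fclass_bounded_cont (R : realType) d m (B : R) (f : d.-tuple R -> R) :
  Fclass m B f -> bounded_cont B f.
Proof. by move=> fB; split; [case: fB => -[]|exact: Fclass_le fB]. Qed.

(** Zero is the degenerate fooling function with no cell selected and height 0, so its regularity
    comes from [Fclass_fool]. *)
Lemma Fclass0 (R : realType) d m (B : R) : 0 <= B -> Fclass m B (fun _ : d.-tuple R => 0 : R).
Proof.
move=> B0.
pose w (c : {ffun 'I_d -> 'I_1}) := false.
have E s : @fool R m d 1 w 0 s = (fun=> 0).
  by apply/funext => x; rewrite /fool big1// => c _; rewrite !mul0r.
have [K K1 KP] := @cell_bump_bounded R m.
rewrite -(E [::]); apply: (@Fclass_fool _ _ _ _ _ _ _ _ K) => //.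
- exact: le_trans K1.
- by rewrite !mul0r.
Qed.

Lemma agree_on_grid_cube (R : realType) (m d : nat) : exists2 C : R, 0 <= C &
  forall (B : R) (N : nat) (f g : d.-tuple R -> R), 0 < B -> (0 < N)%N ->
    Fclass m B f -> Fclass m B g ->
    (forall x : d.-tuple R, (forall i, exists2 j, (j < N)%N & tnth x i = grid_node R N j) ->
       f x = g x) ->
    forall x, cube x -> `|f x - g x| <= C * (B * N%:R^-1 ^+ m).
Proof.
have [C C0 CP] := @agree_on_grid R m d; exists C => // B N f g B0 N0 fB gB fg x xc.
set K := _ * _; apply/ler_addgt0Pr => e e0.
have [[[cf _ _] _] [[cg _ _] _]] := (fB, gB).
have e2 : 0 < e / 2 by rewrite divr_gt0.
have [d1 d10 f1] := cf x xc _ e2; have [d2 d20 g1] := cg x xc _ e2.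
pose s := Num.min (1 / 2) (Num.min d1 d2 / 2).
have s0 : 0 < s by rewrite lt_min divr_gt0//= divr_gt0// lt_min d10.
have s1 : s <= 1 / 2 by rewrite ge_min lexx.
have sd : s <= Num.min d1 d2 / 2 by rewrite ge_min lexx orbT.
have m0 : 0 < Num.min d1 d2 by rewrite lt_min d10.
(* x is approached from the open cube, along the segment to the centre; each coordinate moves by at
   most s/2. *)
pose y : d.-tuple R := [tuple (1 - s) * tnth x i + s / 2 | i < d].
have yI : interior_cube y.
  by move=> i; rewrite tnth_mktuple; have /andP[? ?] := xc i; apply/andP; split; nra.
have yx i : `|tnth y i - tnth x i| < Num.min d1 d2.
  rewrite tnth_mktuple; have /andP[? ?] := xc i.
  by rewrite ltr_norml; apply/andP; split; nra.
have yc := interior_cube_sub yI.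
have {}f1 : `|f y - f x| < e / 2.
  by apply: f1 => // i; rewrite (lt_le_trans (yx i))// ge_min lexx.
have {}g1 : `|g y - g x| < e / 2.
  by apply: g1 => // i; rewrite (lt_le_trans (yx i))// ge_min lexx orbT.
have := CP B N f g B0 N0 fB gB fg y yI; rewrite -/K.
move: f1 g1; rewrite !ltr_norml !ler_norml => /andP[? ?] /andP[? ?] /andP[? ?].
by apply/andP; split; lra.
Qed.

(** Bumps are placed on exactly the cells that contain none of the points p k. At least half of the
    cells are free, so int f is of the order of the height of a bump, and that height is B times the
    m-th power of the cell size up to constants. *)
Lemma fooling_function (R : realType) (m d : nat) : (0 < d)%N -> exists2 c0 : R, 0 < c0 &
  forall (B : R) (n N : nat) (p : nat -> d.-tuple R), 0 < B -> (0 < N)%N -> (n < N.+1 ^ d)%N ->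
  exists f : d.-tuple R -> R,
  [/\ Fclass m B f, forall x i, 1 / 2 <= tnth x i -> f x = 0,
      forall k, (k < n)%N -> f (p k) = 0 & expR (c0 * (B * N%:R^-1 ^+ m)) <= Zf f].
Proof.
move=> d0; have [K K1 KP] := @cell_bump_bounded R m.
have K0 : 0 < K by exact: lt_le_trans K1.
pose kap : R := (1 / 8) ^+ m.+1.
have kap0 : 0 < kap by rewrite exprn_gt0//; lra.
exists (kap ^+ d / (8 ^+ m * K ^+ d * (2 * 4 ^+ d))).
  by rewrite divr_gt0 ?mulr_gt0 ?exprn_gt0.
move=> B n N p B0 N0 nN.
(* The factor 2 yields 2^d (N+1)^d >= 2 n cells, using d >= 1; the n points hit at most half of
   them. *)
pose M := (2 * N.+1)%N; pose a : R := (2 * M)%:R.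
have M0 : (0 < M)%N by [].
have MR : 0 < M%:R :> R by rewrite ltr0n.
have aR : 0 < a by rewrite ltr0n muln_gt0.
have NR : 0 < N%:R :> R by rewrite ltr0n.
pose sel (c : {ffun 'I_d -> 'I_M}) := c \notin [seq cell M0 (p k) | k <- iota 0 n].
have nM : (2 * n <= M ^ d)%N.
  rewrite expnMn leq_mul//; last exact: ltnW.
  by rewrite -[leqLHS]expn1 leq_pexp2l.
have card_sel : (M ^ d <= 2 * #|sel|)%N.
  have h1 : (#|[seq cell M0 (p k) | k <- iota 0 n]| + #|sel| = M ^ d)%N.
    have := cardC (mem [seq cell M0 (p k) | k <- iota 0 n]).
    by rewrite card_ffun !card_ord => <-; congr (_ + _)%N; exact: eq_card.
  have := card_size [seq cell M0 (p k) | k <- iota 0 n].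
  rewrite size_map size_iota; move: h1 nM.
  by move: (#|_|) (#|sel|) (M ^ d)%N => u v z; lia.
(* The height at which the bound of [fool_le] equals B. *)
pose eta := B / (a ^+ m * K ^+ d).
have aK : 0 < a ^+ m * K ^+ d by rewrite mulr_gt0// exprn_gt0.
have eta0 : 0 < eta by rewrite divr_gt0.
have fB : Fclass m B (@fool R m d M sel eta [::]).
  apply: (@Fclass_fool R m d M sel eta M0 (ltW eta0) K B (ltW K0) KP).
  by rewrite -/a -mulrA divfK// gt_eqF.
exists (@fool R m d M sel eta [::]); split => //.
- by move=> x i; exact: fool_half.
- move=> k kn; apply: (@fool_cell R m d M sel eta M0); rewrite negbK.
  by apply/mapP; exists k => //; rewrite mem_iota.
have B0' := ltW B0.
apply: (Zf_jensen B0' (Fclass_bounded_cont fB)) => //.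
- by move=> x; exact: (@fool_ge0 R m d M sel eta M0 (ltW eta0)).
- by rewrite !mulr_ge0 ?exprn_ge0 ?invr_ge0 ?mulr_ge0 ?exprn_ge0 ?(ltW kap0) ?(ltW K0).
apply: le_trans (@integral_fool R m d M sel eta M0 (ltW eta0)); rewrite lee_fin -/kap.
have sR : M%:R ^+ d <= 2 * #|sel|%:R :> R by rewrite -natrX -natrM ler_nat.
(* As N >= 1, a = 4 (N + 1) is at most 8 N; this is the source of 8^m in the constant. *)
have a8 : a <= 8 * N%:R by rewrite -natrM ler_nat /M; clear -N0; lia.
apply: (@le_trans _ _ (eta * (M%:R ^+ d / 2) * (kap / (4 * M%:R)) ^+ d)); last first.
  rewrite ler_wpM2r ?exprn_ge0 ?divr_ge0 ?mulr_ge0 ?(ltW kap0) ?(ltW MR)//.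
  by rewrite ler_wpM2l ?(ltW eta0)// ler_pdivrMr// mulrC.
(* The powers M^d cancel, since the number of free cells times the volume of a cell is of order 1;
   only a^(-m) remains. *)
have -> : eta * (M%:R ^+ d / 2) * (kap / (4 * M%:R)) ^+ d =
   kap ^+ d / (K ^+ d * (2 * 4 ^+ d)) * (B / a ^+ m).
  rewrite /eta expr_div_n exprMn; field.
  by rewrite !gt_eqF ?exprn_gt0.
have -> : kap ^+ d / (8 ^+ m * K ^+ d * (2 * 4 ^+ d)) * (B * N%:R^-1 ^+ m) =
   kap ^+ d / (K ^+ d * (2 * 4 ^+ d)) * (B / (8 * N%:R) ^+ m).
  rewrite exprVn exprMn; field.
  by rewrite !gt_eqF ?exprn_gt0.
rewrite ler_wpM2l ?divr_ge0 ?mulr_ge0 ?exprn_ge0 ?(ltW kap0) ?(ltW K0)//.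
rewrite ler_wpM2l ?(ltW B0)// lef_pV2 ?posrE ?exprn_gt0 ?mulr_gt0//.
by rewrite lerXn2r ?nnegrE ?mulr_ge0 ?(ltW aR) ?(ltW NR).
Qed.

(** * Algorithms and minimal errors *)

Section algorithms.
Variables (R : realType) (d : nat) (Sol Out : Type) (F : set (d.-tuple R -> R)).
Variables (S : (d.-tuple R -> R) -> Sol) (valid : Out -> Prop) (D : Sol -> Out -> \bar R).

(** As long as all answers are 0, the history is a list of zeros and the next point is known
    beforehand; so it is enough that f vanishes at these n points. *)
Lemma adinfo_zero (psi : seq R -> d.-tuple R) f n :
  (forall k, (k < n)%N -> f (psi (nseq k 0)) = 0) -> adinfo psi f n = nseq n 0.
Proof.
elim: n => //= n IH f0; rewrite IH; last by move=> k kn; apply: f0; rewrite ltnS ltnW.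
by rewrite f0// -[RHS]/(nseq n.+1 0) -addn1 nseqD cats1.
Qed.

Lemma err_ad_n_ge n (L : \bar R) :
  (forall psi : seq R -> d.-tuple R, exists f g, [/\ F f, F g,
     adinfo psi f n = adinfo psi g n &
     forall (Q : Out) e, valid Q -> D (S f) Q <= e -> D (S g) Q <= e -> L <= e])%E ->
  (L <= err_ad_n F S valid D n)%E.
Proof.
move=> H; apply: le_ereal_inf_tmp => _ [psi [phi [_ vphi ->]]].
have [f [g [Ff Fg fg]]] := H psi; apply; first exact: (vphi (adinfo psi f n)).
  by apply: ereal_sup_ubound; exists f.
by apply: ereal_sup_ubound; exists g => //; rewrite fg.
Qed.

Lemma err_n_le n (U : \bar R) (xs : n.-tuple (d.-tuple R)) :
  (forall k, cube (tnth xs k)) -> (exists Q, valid Q) ->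
  (forall g, F g -> exists2 Q, valid Q &
     forall f, F f -> map_tuple f xs = map_tuple g xs -> (D (S f) Q <= U)%E) ->
  (err_n F S valid D n <= U)%E.
Proof.
move=> xsc [Q0 vQ0] H.
have [phi phiP] : {phi : n.-tuple R -> Out & forall y, valid (phi y) /\
    forall f, F f -> map_tuple f xs = y -> (D (S f) (phi y) <= U)%E}.
  apply: (@choice _ _ (fun y Q => valid Q /\
    forall f, F f -> map_tuple f xs = y -> (D (S f) Q <= U)%E)) => y.
  (* Data produced by some g in the class get the output made for g, which serves every f with the
     same data; all other data get the default [Q0]. *)
  have [[g [Fg gy]]|ng] := pselect (exists g, F g /\ map_tuple g xs = y).
    by have [Q vQ QP] := H g Fg; exists Q; split => // f Ff fy; apply: QP; rewrite // fy.
  by exists Q0; split => // f Ff fy; exfalso; apply: ng; exists f.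
apply: (@le_trans _ _ (ereal_sup [set D (S f) (phi (map_tuple f xs)) | f in F])).
  apply: ereal_inf_lbound; exists xs, phi; split => // y.
  by have [] := phiP y.
apply: ge_ereal_sup => _ [f Ff <-]; have [_] := phiP (map_tuple f xs); exact.
Qed.

(** A fixed design is an adaptive one that looks only at the length of the history. After n or more
    answers it asks the origin, since [psi] must stay in the cube for every history. *)
Lemma err_ad_n_le n : (err_ad_n F S valid D n <= err_n F S valid D n)%E.
Proof.
apply: le_ereal_inf_tmp => _ [xs [phi [xsc vphi ->]]].
pose x0 : d.-tuple R := [tuple 0 | _ < d].
pose psi (h : seq R) := nth x0 xs (size h).
pose phi' (s : seq R) := phi [tuple nth 0 s i | i < n].
have info f k : (k <= n)%N -> adinfo psi f k = [seq f x | x <- take k xs].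
  elim: k => [|k IH] kn /=; first by rewrite take0.
  rewrite IH 1?ltnW// /psi size_map size_takel ?size_tuple 1?ltnW//.
  by rewrite (take_nth x0) ?size_tuple// map_rcons.
have phiE f : phi' (adinfo psi f n) = phi (map_tuple f xs).
  congr phi; apply: eq_from_tnth => i.
  rewrite tnth_mktuple info// take_oversize ?size_tuple// tnth_map (tnth_nth x0).
  by rewrite (nth_map x0) ?size_tuple.
apply: ereal_inf_lbound; exists psi, phi'; split.
- move=> h; rewrite /psi; have [hn|hn] := ltnP (size h) n.
    by have := xsc (Ordinal hn); rewrite (tnth_nth x0).
  rewrite nth_default ?size_tuple// => i; by rewrite tnth_mktuple lexx ler01.
- by move=> y; exact: vphi.
- by congr ereal_sup; apply/seteqP; split => _ [f Ff <-]; exists f => //; rewrite phiE.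
Qed.

End algorithms.

Lemma grid_points (R : realType) (d n N : nat) : (0 < N)%N -> (N ^ d <= n)%N ->
  exists2 xs : n.-tuple (d.-tuple R), (forall k, cube (tnth xs k)) &
  forall f g : d.-tuple R -> R, map_tuple f xs = map_tuple g xs ->
    forall x : d.-tuple R, (forall i, exists2 j, (j < N)%N & tnth x i = grid_node R N j) ->
      f x = g x.
Proof.
move=> N0 Nn.
pose pt (c : {ffun 'I_d -> 'I_N}) : d.-tuple R := [tuple grid_node R N (c i) | i < d].
pose c0 : {ffun 'I_d -> 'I_N} := [ffun=> Ordinal N0].
(* When n exceeds N^d, [nth] fills the remaining positions with the grid point of index [c0]. *)
pose xs : n.-tuple (d.-tuple R) := [tuple pt (nth c0 (enum {ffun 'I_d -> 'I_N}) k) | k < n].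
exists xs.
  move=> k i; rewrite !tnth_mktuple.
  by have /andP[? ?] := @grid_node_itv R N _ (ltn_ord (nth c0 (enum {ffun 'I_d -> 'I_N}) k i));
    rewrite !ltW.
move=> f g fg x xN.
have xj i : exists j : 'I_N, tnth x i = grid_node R N j.
  by have [j jN ->] := xN i; exists (Ordinal jN).
have [c cP] := choice xj.
have -> : x = pt (finfun c) by apply: eq_from_tnth => i; rewrite tnth_mktuple ffunE.
have kn : (index (finfun c) (enum {ffun 'I_d -> 'I_N}) < n)%N.
  apply: leq_trans Nn; have := index_mem (finfun c) (enum {ffun 'I_d -> 'I_N}).
  by rewrite mem_enum -cardE card_ffun !card_ord.
have := congr1 (fun t => tnth t (Ordinal kn)) fg.
by rewrite !tnth_map !tnth_ord_tuple /= nth_index ?mem_enum.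
Qed.

Lemma rate_ge0 (R : realType) (m d n : nat) (B : R) : 0 < B -> 0 <= rate m d B n.
Proof. by move=> B0; rewrite mulr_ge0 ?powR_ge0// ltW. Qed.

Lemma grid_recovery (R : realType) (m d : nat) : (0 < d)%N -> exists2 C : R, 0 <= C &
  forall (B : R) (n : nat), 0 < B -> (0 < n)%N ->
  exists2 xs : n.-tuple (d.-tuple R), (forall k, cube (tnth xs k)) &
  forall f g, Fclass m B f -> Fclass m B g -> map_tuple f xs = map_tuple g xs ->
    forall x, cube x -> `|f x - g x| <= C * rate m d B n.
Proof.
move=> d0; have [C C0 CP] := @agree_on_grid_cube R m d.
exists (C * 2 ^+ m); first by rewrite mulr_ge0// exprn_ge0.
move=> B n B0 n0; have [N N0 Nn] := nat_root d0 n0.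
have /andP[_ r2] := rate_itv m d0 N0 B0 Nn.
have /andP[Nn1 _] := Nn.
have [xs xsc xsP] := @grid_points R d n N N0 Nn1.
exists xs => // f g fB gB fg x xc.
apply: le_trans (CP B N f g B0 N0 fB gB (xsP f g fg) x xc) _.
by rewrite -mulrA ler_wpM2l.
Qed.

Lemma fooling_rate (R : realType) (m d : nat) : (0 < d)%N -> exists2 c : R, 0 < c &
  forall (B : R) (n : nat) (psi : seq R -> d.-tuple R), 0 < B -> (0 < n)%N ->
  exists f : d.-tuple R -> R,
  [/\ Fclass m B f, forall x i, 1 / 2 <= tnth x i -> f x = 0,
      adinfo psi f n = adinfo psi (fun=> 0) n & expR (c * rate m d B n) <= Zf f].
Proof.
move=> d0; have [c c0 cP] := @fooling_function R m d d0; exists c => // B n psi B0 n0.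
have [N N0 Nn] := nat_root d0 n0.
have /andP[r1 _] := rate_itv m d0 N0 B0 Nn.
have /andP[_ nN] := Nn.
have [f [fB f0 fp fZ]] := cP B n N (fun k => psi (nseq k 0)) B0 N0 nN.
exists f; split => //; first by rewrite !adinfo_zero.
by apply: le_trans fZ; rewrite ler_expR ler_pM2l.
Qed.

(** Since the adaptive error is at most the nonadaptive one, a lower bound for the former and an
    upper bound for the latter settle all four inequalities. *)
Lemma Theta_md_both (R : realType) (Sol Out : nat -> Type)
    (S : forall d, (d.-tuple R -> R) -> Sol d) (valid : forall d, Out d -> Prop)
    (D : forall d, Sol d -> Out d -> \bar R) (h : nat -> nat -> R -> nat -> R) :
  (forall m d, (0 < d)%N -> exists2 c : R, 0 < c & forall B n, 0 < B -> (0 < n)%N ->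
     ((c * h m d B n)%:E <= err_ad_n (@Fclass R d m B) (@S d) (@valid d) (@D d) n)%E) ->
  (forall m d, (0 < d)%N -> exists2 C : R, 0 < C & forall B n, 0 < B -> (0 < n)%N ->
     (err_n (@Fclass R d m B) (@S d) (@valid d) (@D d) n <= (C * h m d B n)%:E)%E) ->
  Theta_md (fun m d B n => err_n (@Fclass R d m B) (@S d) (@valid d) (@D d) n) h /\
  Theta_md (fun m d B n => err_ad_n (@Fclass R d m B) (@S d) (@valid d) (@D d) n) h.
Proof.
move=> lo up; split => m d m0 d0;
  have [c c0 cP] := lo m d d0; have [C C0 CP] := up m d d0;
  exists c, C; split => // B n B0 n0; split.
- exact: le_trans (cP B n B0 n0) (err_ad_n_le _ _ _ _ _).
- exact: CP.
- exact: cP.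
- exact: le_trans (err_ad_n_le _ _ _ _ _) (CP B n B0 n0).
Qed.

(** Isolates what depends on the metric: [L t] is the error forced on an output that serves both 0
    and an f vanishing on a half-space with Z_f >= exp(t). The second hypothesis converts [L] at a
    multiple of the rate into the claimed order. *)
Lemma err_ad_n_lower_bound (R : realType) (Sol Out : nat -> Type)
    (S : forall d, (d.-tuple R -> R) -> Sol d) (valid : forall d, Out d -> Prop)
    (D : forall d, Sol d -> Out d -> \bar R) (h : nat -> nat -> R -> nat -> R) (L : R -> R) :
  (forall d (i0 : 'I_d) (B t : R) (f : d.-tuple R -> R) (Q : Out d) e,
     0 <= B -> 0 <= t -> bounded_cont B f ->
     (forall x, 1 / 2 <= tnth x i0 -> f x = 0) -> expR t <= Zf f -> valid d Q ->
     (D d (S d f) Q <= e -> D d (S d (fun=> 0)%R) Q <= e -> (L t)%:E <= e)%E) ->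
  (forall c : R, 0 < c -> exists2 c', 0 < c' & forall m d B n, 0 < B ->
     c' * h m d B n <= L (c * rate m d B n)) ->
  forall m d, (0 < d)%N -> exists2 c : R, 0 < c & forall B n, 0 < B -> (0 < n)%N ->
    ((c * h m d B n)%:E <= err_ad_n (@Fclass R d m B) (@S d) (@valid d) (@D d) n)%E.
Proof.
move=> DL Lh m d d0; have [c c0 cP] := @fooling_rate R m d d0.
have [c' c'0 c'P] := Lh c c0; exists c' => // B n B0 n0.
apply: (@le_trans _ _ (L (c * rate m d B n))%:E); first by rewrite lee_fin c'P.
apply: err_ad_n_ge => psi; have [f [fB f0 fpsi fZ]] := cP B n psi B0 n0.
exists f, (fun=> 0); split => //; first exact: Fclass0 (ltW B0).
move=> Q e vQ; apply: (DL d (Ordinal d0) B) => //.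
- exact: ltW.
- by rewrite mulr_ge0 ?rate_ge0// ltW.
- exact: Fclass_bounded_cont fB.
- by move=> x; exact: f0.
Qed.

(** [U d e] bounds the error of the output made for g at any f within e of g. The output [Q] is
    chosen before e and f because it may depend on the data only. *)
Lemma err_n_upper_bound (R : realType) (Sol Out : nat -> Type)
    (S : forall d, (d.-tuple R -> R) -> Sol d) (valid : forall d, Out d -> Prop)
    (D : forall d, Sol d -> Out d -> \bar R) (h : nat -> nat -> R -> nat -> R)
    (U : nat -> R -> R) :
  (forall d (B : R) (g : d.-tuple R -> R), 0 <= B -> bounded_cont B g ->
     exists2 Q, valid d Q & forall e f, 0 <= e -> bounded_cont B f ->
       (forall x, cube x -> `|f x - g x| <= e) -> (D d (S d f) Q <= (U d e)%:E)%E) ->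
  (forall d (c : R), 0 <= c -> exists2 c', 0 < c' & forall m B n, 0 < B ->
     U d (c * rate m d B n) <= c' * h m d B n) ->
  forall m d, (0 < d)%N -> exists2 C : R, 0 < C & forall B n, 0 < B -> (0 < n)%N ->
    (err_n (@Fclass R d m B) (@S d) (@valid d) (@D d) n <= (C * h m d B n)%:E)%E.
Proof.
move=> DU Uh m d d0; have [c c0 cP] := @grid_recovery R m d d0.
have [c' c'0 c'P] := Uh d c c0; exists c' => // B n B0 n0.
have [xs xsc xsP] := cP B n B0 n0.
apply: (@le_trans _ _ (U d (c * rate m d B n))%:E); last by rewrite lee_fin c'P.
apply: (err_n_le xsc).
  have [Q vQ _] := DU d B _ (ltW B0) (Fclass_bounded_cont (@Fclass0 R d m B (ltW B0))).
  by exists Q.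
move=> g gB; have [Q vQ QP] := DU d B g (ltW B0) (Fclass_bounded_cont gB).
exists Q => // f fB fg; apply: QP.
- by rewrite mulr_ge0// rate_ge0.
- exact: Fclass_bounded_cont fB.
- by move=> x; exact: xsP.
Qed.

Theorem theorem4 (R : realType) :
  Theta_md (fun m d B n => err_n (@Fclass R d m B) (@Lf R d) (fun _ : R => True) (@D_abs R) n)
        (@rate R) /\
      Theta_md (fun m d B n => err_ad_n (@Fclass R d m B) (@Lf R d) (fun _ : R => True) (@D_abs R) n)
        (@rate R) /\
      Theta_md (fun m d B n => err_n (@Fclass R d m B) (@Pf R d) (@distr_on_cube R d) (@D_suplog R d) n)
        (@rate R) /\
      Theta_md (fun m d B n => err_ad_n (@Fclass R d m B) (@Pf R d) (@distr_on_cube R d) (@D_suplog R d) n)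
        (@rate R) /\
      Theta_md (fun m d B n => err_n (@Fclass R d m B) (@Pf R d) (@distr_on_cube R d) (@D_TV R d) n)
        (@rate1 R) /\
      Theta_md (fun m d B n => err_ad_n (@Fclass R d m B) (@Pf R d) (@distr_on_cube R d) (@D_TV R d) n)
        (@rate1 R) /\
      Theta_md (fun m d B n => err_n (@Fclass R d m B) (@Pf R d) (@distr_on_cube R d) (@W1 R d) n)
        (@rate1 R) /\
    Theta_md (fun m d B n => err_ad_n (@Fclass R d m B) (@Pf R d) (@distr_on_cube R d) (@W1 R d) n)
        (@rate1 R).
Proof.
pose PT d := set (d.-tuple R) -> \bar R.
pose QT d := probability (d.-tuple R) R.
have lin_lo (c : R) : 0 < c -> exists2 c', 0 < c' & forall m d B n, 0 < B ->
    c' * @rate R m d B n <= (c * rate m d B n) / 2.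
  by move=> c0; exists (c / 2) => [|m d B n _]; [rewrite divr_gt0|rewrite mulrAC].
have exp_lo (k : R) : 0 < k -> forall c : R, 0 < c -> exists2 c', 0 < c' &
    forall m d B n, 0 < B ->
    c' * @rate1 R m d B n <= (1 - expR (- (c * rate m d B n))) / k.
  (* The factors come from taking c out of the minimum, from [one_sub_expRN_ge] and from the
     division by k. *)
  move=> k0 c c0; exists (c / (1 + c) / 2 / k).
    by rewrite !divr_gt0// addr_gt0.
  move=> m d B n B0; have r0 := rate_ge0 m d n B0.
  rewrite mulrAC ler_pM2r ?invr_gt0// mulrAC.
  apply: le_trans (one_sub_expRN_ge (mulr_ge0 (ltW c0) r0)).
  by rewrite ler_pM2r// min1_scale_ge.
have exp_up (k : nat -> R) : (forall d, 0 <= k d) -> forall d (c : R), 0 <= c ->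
    exists2 c', 0 < c' & forall m B n, 0 < B ->
    k d * (1 - expR (- (2 * (c * rate m d B n)))) <= c' * @rate1 R m d B n.
  move=> k0 d c c0; have kc : 0 <= k d * (1 + 2 * c) by rewrite mulr_ge0// addr_ge0// mulr_ge0.
  (* Adding 1 keeps the constant positive, as k d is only known to be nonnegative. *)
  exists (1 + k d * (1 + 2 * c)); first by rewrite ltr_wpDr.
  move=> m B n B0; have r0 := rate_ge0 m d n B0.
  have c20 : 0 <= 2 * c by rewrite mulr_ge0.
  apply: (@le_trans _ _ (k d * ((1 + 2 * c) * rate1 m d B n))).
    rewrite ler_wpM2l// (le_trans (one_sub_expRN_le _))// mulrA.
    exact: min1_scale.
  rewrite mulrA ler_wpM2r ?lerDr// /rate1 le_min ler01 r0//.
have lin_up (k : R) : 0 <= k -> forall (d : nat) (c : R), 0 <= c ->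
    exists2 c', 0 < c' & forall m B n, 0 < B ->
    k * (c * rate m d B n) <= c' * @rate R m d B n.
  move=> k0 d c c0; exists (1 + k * c); first by rewrite ltr_wpDr// mulr_ge0.
  by move=> m B n B0; rewrite mulrA ler_wpM2r ?rate_ge0// lerDr.
have [||A1 A2] := @Theta_md_both R (fun=> R) (fun=> R) (@Lf R) (fun=> fun=> True)
    (fun=> @D_abs R) (@rate R).
- apply: (@err_ad_n_lower_bound R (fun=> R) (fun=> R) (@Lf R) (fun=> fun=> True) (fun=> @D_abs R)
    (@rate R) (fun t => t / 2)) => // d i0 B t f Q e B0 t0 fB f0 ft _.
  exact: D_abs_lower B0 t0 ft Q e.
- apply: (@err_n_upper_bound R (fun=> R) (fun=> R) (@Lf R) (fun=> fun=> True) (fun=> @D_abs R)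
    (@rate R) (fun=> *%R 1)); last exact: lin_up.
  move=> d B g B0 gB; exists (Lf g) => // e f e0 fB fg.
  by rewrite mul1r lee_fin; exact: Lf_dist B0 e0 fB gB fg.
have [||B1 B2] := @Theta_md_both R PT QT (@Pf R) (@distr_on_cube R) (@D_suplog R) (@rate R).
- apply: (@err_ad_n_lower_bound R PT QT (@Pf R) (@distr_on_cube R) (@D_suplog R) (@rate R)
    (fun t => t / 2)) => // d i0 B t f Q e B0 t0 fB f0 ft _.
  exact: D_suplog_lower B0 t0 fB f0 ft Q e.
- apply: (@err_n_upper_bound R PT QT (@Pf R) (@distr_on_cube R) (@D_suplog R) (@rate R)
    (fun=> *%R 2)); last exact: lin_up.
  move=> d B g B0 gB; have [Q [Qc QE IQ]] := gibbs_probability B0 gB.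
  exists Q => // e f e0 fB fg; exact: D_suplog_le B0 e0 fB gB fg Q IQ.
have [||C1 C2] := @Theta_md_both R PT QT (@Pf R) (@distr_on_cube R) (@D_TV R) (@rate1 R).
- apply: (@err_ad_n_lower_bound R PT QT (@Pf R) (@distr_on_cube R) (@D_TV R) (@rate1 R)
    (fun t => (1 - expR (- t)) / 8)); last exact: exp_lo.
  move=> d i0 B t f Q e B0 t0 fB f0 ft _; exact: D_TV_lower B0 t0 fB f0 ft Q e.
- apply: (@err_n_upper_bound R PT QT (@Pf R) (@distr_on_cube R) (@D_TV R) (@rate1 R)
    (fun=> fun e => 1 * (1 - expR (- (2 * e))))); last exact: (exp_up (fun=> 1)).
  move=> d B g B0 gB; have [Q [Qc QE IQ]] := gibbs_probability B0 gB.
  exists Q => // e f e0 fB fg; rewrite mul1r; exact: D_TV_le B0 e0 fB gB fg Q QE.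
have [||D1 D2] := @Theta_md_both R PT QT (@Pf R) (@distr_on_cube R) (@W1 R) (@rate1 R).
- apply: (@err_ad_n_lower_bound R PT QT (@Pf R) (@distr_on_cube R) (@W1 R) (@rate1 R)
    (fun t => (1 - expR (- t)) / 32)); last exact: exp_lo.
  move=> d i0 B t f Q e B0 t0 fB f0 ft _; exact: W1_lower B0 t0 fB f0 ft Q e.
- apply: (@err_n_upper_bound R PT QT (@Pf R) (@distr_on_cube R) (@W1 R) (@rate1 R)
    (fun d e => Num.sqrt d%:R * (1 - expR (- (2 * e))))); last first.
    by apply: (exp_up (fun d => Num.sqrt d%:R)) => d; exact: sqrtr_ge0.
  move=> d B g B0 gB; have [Q [Qc QE IQ]] := gibbs_probability B0 gB.
  exists Q => // e f e0 fB fg; exact: W1_le B0 e0 fB gB fg Q Qc QE.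
by do 7 split => //.
Qed.
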